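(* Assume that $f_0$ is bounded by $M$ and satisfies $\inf_{0<x\le1}f_0(x)\ge\delta>0$. Let $\hat f_n(\cdot)$ be the density estimator on $(0,1]$ defined in the context, with thresholds $\zeta_n=O(\sqrt{\log n})$ that satisfy the uniform propagation condition $\mathrm{UP}(\alpha,\mathcal F_{j,k})$ (for a fixed $\alpha>0$) for $$\mathcal F_{j,k}=V_{j,k}\cap\Bigl\{f:\ 0<\delta\le\inf_{0<x\le1}f(x),\ \|f\|_\infty\le M\Bigr\}.$$ Suppose that $f_0\in\mathcal C(t(x),x,L(x),\eta(x))$ for every $0<x\le1$, for some functions $t(\cdot),L(\cdot),\eta(\cdot)$ (with $0<t(x)\le1$) that are bounded and uniformly bounded away from zero on $(0,1]$. For $x\in(0,1]$ let $$\Delta_{j,x}(f_0)=c(x)^2\frac{L(x)}{\delta^2}2^{-j(2t(x)+1)},\qquad j^*(x)=\min\{j\in\mathbb N:\ j\le j_{\max},\ n\Delta_{j,x}(f_0)\le\Delta\log n\},$$ with a fixed positive constant $\Delta<1/2$, where $c(x)=c(t(x),L(x),\eta(x))$ is the constant specified in the context. Then $$\sup_{0<x\le1}\left(\frac{n}{\log n}\right)^{t(x)/(2t(x)+1)}\bigl|\hat f_n(x)-f_0(x)\bigr|=O_{\Pr_{f_0}}(1),$$ i.e. this sequence of random variables is bounded in probability under $f_0$ as $n\to\infty$.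
   Context: $\mathbb N=\{0,1,2,\dots\}$. $\|g\|_\infty=\sup_{x\in\mathbb R}|g(x)|$. Data: $X_1,\dots,X_n$ ($n>1$) are i.i.d. with density $f_0:\mathbb R\to[0,\infty)$. $E_f,\Pr_f$ denote expectation and probability when the $X_i$ are i.i.d. with density $f$. Local Hölder balls: for $0<t\le1$, $x\in\mathbb R$, $L,\eta>0$, $$\mathcal C(t,x,L,\eta)=\Bigl\{g:\mathbb R\to\mathbb R:\ \max\Bigl(\|g\|_\infty,\ \sup_{0<|m|\le\eta}\frac{|g(x+m)-g(x)|}{|m|^t}\Bigr)\le L\Bigr\}.$$ Dyadic intervals: $I_{j,k}=(k2^{-j},(k+1)2^{-j}]$ for $j\in\mathbb N$, $k=0,\dots,2^j-1$; for $x\in(0,1]$, $I_{j,k(x)}$ is the unique such interval containing $x$. $V_{j,k}$ is the set of all bounded probability density functions on $\mathbb R$ that are constant on $I_{j,k}$. For a bounded density $f$ and $x\in(0,1]$, $K_{j,x}(f)(z)=2^j\int_{I_{j,k(x)}}f(y)\,dy$ if $z\in I_{j,k(x)}$ and $K_{j,x}(f)(z)=f(z)$ otherwise. Constant $c(t,L,\eta)$: a finite constant depending only on $t,L,\eta$ such that $\|f-K_{j,x}(f)\|_\infty\le c(t,L,\eta)2^{-jt}$ for all $j\in\mathbb N$, all $x\in(0,1]$ and all densities $f\in\mathcal C(t,x,L,\eta)$. Linear (dyadic histogram) estimator: $f_n(j,x)=\frac1n\sum_{i=1}^n2^j1_{I_{j,k(x)}}(X_i)$ for $x\in(0,1]$.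 Set $1/s_n(j,x)=1/\sqrt{f_n(j,x)}$ if $f_n(j,x)>0$ and $1/s_n(j,x)=0$ otherwise. Maximal level: $j_{\max}=j_{\max,n}\in\mathbb N$ is fixed with $2^{-j_{\max}}\ge d(\log n)^2/n$ for some $d>0$. Adaptive estimator: for thresholds $\zeta_n$, $J\in\mathbb N$ with $J\le j_{\max}$ and $x\in(0,1]$, let $$\hat j_n(J,x)=\min\Bigl\{j\in\mathbb N,\ J\le j\le j_{\max}:\ \sqrt{n2^{-j'}}\,|f_n(j',x)-f_n(j,x)|\le\zeta_n\sqrt{f_n(j,x)}\ \text{ for all } j'\text{ with } j<j'\le j_{\max}\Bigr\}$$ (and $\hat j_n(J,x)=j_{\max}$ if the condition is not met for any such $j$), $\hat f_n(J,x)=f_n(\hat j_n(J,x),x)$, and $\hat f_n(x)=\hat f_n(0,x)$. Uniform propagation condition: the thresholds $\zeta_n$ satisfy $\mathrm{UP}(\alpha,\mathcal F_{j,k})$ if for every $n$, every $j\le j_{\max}$, every $m=0,\dots,2^{j_{\max}}-1$, and every $f\in\mathcal F_{j,k(m)}$, where $k(m)$ is the unique $k$ with $I_{j_{\max},m}\subseteq I_{j,k}$, $$E_f\left(\sup_{x\in I_{j_{\max},m}}\max_{j\le j'\le j_{\max}}\sqrt{\frac{n2^{-j'}}{\log n}}\left|\frac{\hat f_n(j',x)-f_n(j',x)}{s_n(j',x)}\right|\right)^2\le\frac{\alpha}{n2^{2j_{\max}}}.$$ *)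

(* Defs.v *)
From HB Require Import structures.
From mathcomp Require Import all_boot all_order all_algebra.
From mathcomp Require Import all_classical all_reals all_analysis.
From mathcomp Require Import measurable_realfun.

Set Implicit Arguments.
Unset Strict Implicit.
Unset Printing Implicit Defensive.
Import Order.TTheory GRing.Theory Num.Theory.
Import numFieldNormedType.Exports.
Local Open Scope classical_set_scope.
Local Open Scope ring_scope.

Record density (R : realType) := Density {
  pdf :> R -> R;
  measurable_pdf : measurable_fun [set: R] pdf;
  pdf_ge0 : forall x, 0 <= pdf x;
  integral_pdf : (\int[lebesgue_measure]_x (pdf x)%:E = 1)%E }.

Definition density_prob (R : realType) (f : density R) : set R -> \bar R :=
  fun A => (\int[lebesgue_measure]_(x in A) (f x)%:E)%E.

Section density_prob.
Context (R : realType) (f : density R).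
Local Open Scope ereal_scope.

Let density_prob0 : density_prob f set0 = 0.
Proof. exact: integral_set0. Qed.

Let density_prob_ge0 A : 0 <= density_prob f A.
Proof. by apply: integral_ge0 => x _; rewrite lee_fin pdf_ge0. Qed.

Let density_prob_sigma_additive : semi_sigma_additive (density_prob f).
Proof.
apply: (@semi_sigma_additive_nng_induced _ _ _ lebesgue_measure (EFin \o f)).
- by apply/measurable_EFinP; exact: measurable_pdf.
- by move=> x; rewrite lee_fin pdf_ge0.
Qed.

HB.instance Definition _ := isMeasure.Build _ _ _ (density_prob f)
  density_prob0 density_prob_ge0 density_prob_sigma_additive.

Let density_probT : density_prob f setT = 1.
Proof. exact: integral_pdf. Qed.

HB.instance Definition _ :=
  Measure_isProbability.Build _ _ _ (density_prob f) density_probT.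

End density_prob.

Section tuple_cons.
Context d (T : measurableType d) (n : nat).

Definition tuple_cons (p : T * n.-tuple T) : n.+1.-tuple T :=
  [tuple of p.1 :: p.2].

Let measurable_tuple_cons : measurable_fun [set: T * n.-tuple T] tuple_cons.
Proof. exact: measurable_cons. Qed.

HB.instance Definition _ := isMeasurableFun.Build _ _ _ _ tuple_cons
  measurable_tuple_cons.

End tuple_cons.

(* The n-fold product of P: under [iid P n] the coordinates [tnth X i] of the
   sample X are i.i.d. with law P (lemma [iid_rect]). *)
Fixpoint iid d (T : measurableType d) (R : realType) (P : probability T R)
    (n : nat) : probability (n.-tuple T) R :=
  match n with
  | 0 => \d_([tuple] : 0.-tuple T)
  | n'.+1 => distribution (P \x iid P n')%E (@tuple_cons _ T n')
  end.

(* Law of a sample of size n from the density f; expectations under f are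
   integrals with respect to this measure. *)
Definition Pr (R : realType) (f : density R) (n : nat) :
  probability (n.-tuple R) R := iid (density_prob f) n.

Lemma iid_rect d (T : measurableType d) (R : realType) (P : probability T R)
    (n : nat) (A : 'I_n -> set T) : (forall i, measurable (A i)) ->
  measurable [set X : n.-tuple T | forall i, A i (tnth X i)] /\
  iid P n [set X | forall i, A i (tnth X i)] = (\prod_(i < n) P (A i))%E.
Proof.
elim: n A => [|n IH] A mA.
  have -> : [set X : 0.-tuple T | forall i, A i (tnth X i)] = setT.
    by apply/seteqP; split => // X _ [].
  by split; [exact: measurableT | rewrite big_ord0; exact: diracT].
have [mB PB] := IH (fun i => A (lift ord0 i)) (fun i => mA _).
have mS : measurable [set X : n.+1.-tuple T | forall i, A i (tnth X i)].
  rewrite [X in measurable X](_ : _ =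
      \big[setI/setT]_(i < n.+1) ((fun X => tnth X i) @^-1` A i)).
    apply: bigsetI_measurable => i _; rewrite -[X in measurable X]setTI.
    exact: measurable_tnth.
  apply/seteqP; split => X /=.
    by move=> AX; rewrite -bigcap_seq => i _; exact: AX.
  by rewrite -bigcap_seq => AX i; apply: (AX i) => /=; rewrite mem_index_enum.
split=> //; rewrite big_ord_recl -PB /= /distribution /pushforward.
rewrite -product_measure1E//; congr (product_measure1 _ _ _).
apply/seteqP; split => -[x X] /=.
  move=> AX; split; first exact: (AX ord0).
  by move=> i; have := AX (lift ord0 i); rewrite tnthS.
by move=> [A0 AX] i; case: (unliftP ord0 i) => [j|] ->; rewrite ?tnthS //; exact: AX.
Qed.

Definition supnorm (R : realType) (g : R -> R) : \bar R :=
  ereal_sup [set `|g x|%:E | x in [set: R]].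

Definition inf01 (R : realType) (g : R -> R) : \bar R :=
  ereal_inf [set (g x)%:E | x in [set x : R | 0 < x <= 1]].

Definition holder_seminorm (R : realType) (t x eta : R) (g : R -> R) : \bar R :=
  ereal_sup [set (`|g (x + m) - g x| / `|m| `^ t)%:E |
              m in [set m : R | 0 < `|m| <= eta]].

Definition holder_ball (R : realType) (t x L eta : R) : set (R -> R) :=
  [set g | (maxe (supnorm g) (holder_seminorm t x eta g) <= L%:E)%E].

Definition dyadic (R : realType) (j k : nat) : set R :=
  `](k%:R * 2 ^- j), (k.+1%:R * 2 ^- j)]%classic.

(* The index k(x); by [cell_indexP] it is, for 0 < x <= 1, the unique k < 2^j
   such that x lies in I_{j,k}. *)
Definition cell_index (R : realType) (j : nat) (x : R) : nat :=
  `|Num.ceil (2 ^+ j * x)|%N.-1.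

Lemma cell_indexP (R : realType) (j k : nat) (x : R) : 0 < x <= 1 ->
  ((k < 2 ^ j)%N /\ dyadic j k x) <-> k = cell_index j x.
Proof.
move=> /andP[x0 x1]; have p0 : 0 < 2 ^+ j :> R by rewrite exprn_gt0.
have y0 : 0 < 2 ^+ j * x by rewrite mulr_gt0.
have dyE i : dyadic j i x <-> (i%:R < 2 ^+ j * x <= i.+1%:R).
  by rewrite /dyadic /= in_itv /= ltr_pdivrMr // ler_pdivlMr // (mulrC x).
have c0 : (0 < Num.ceil (2 ^+ j * x))%R by rewrite ceil_gt0.
have [m cE] : exists m, Num.ceil (2 ^+ j * x) = m.+1%:Z.
  by case: (Num.ceil _) c0 => // -[|m] // _; exists m.
have -> : cell_index j x = m by rewrite /cell_index cE.
have := @real_ceil_itv R _ (num_real (2 ^+ j * x)).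
rewrite cE -[m.+1]addn1 PoszD addrK -!pmulrn addn1 => /andP[m1 m2].
split=> [[_ /dyE /andP[k1 k2]]|->].
  have km := lt_le_trans k1 m2; have mk := lt_le_trans m1 k2.
  move: km mk; rewrite !ltr_nat => km mk.
  by apply/eqP; rewrite eqn_leq -(ltnS k) -(ltnS m) km mk.
split; last by apply/dyE; rewrite m1 m2.
rewrite -(ltr_nat R) natrX (lt_le_trans m1) // ler_piMr // ltW //.
Qed.

Definition cell (R : realType) (j : nat) (x : R) : set R :=
  dyadic j (cell_index j x).

Definition Vjk (R : realType) (j k : nat) : set (density R) :=
  [set f | (supnorm f < +oo)%E /\
           exists a : R, forall y, dyadic j k y -> f y = a].

(* K_{j,x}(f) *)
Definition haar_proj (R : realType) (j : nat) (x : R) (f : R -> R) : R -> R :=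
  fun z => if z \in cell j x
           then 2 ^+ j * \int[lebesgue_measure]_(y in cell j x) f y
           else f z.

(* c(t, L, eta) is any real number, depending only on t, L and eta, that bounds
   the bias uniformly over j, x and the densities of the local Hoelder ball. *)
Definition haar_bias_constant (R : realType) (c : R -> R -> R -> R) :=
  forall t L eta : R, 0 < t <= 1 -> 0 < L -> 0 < eta ->
  forall (j : nat) (x : R), 0 < x <= 1 ->
  forall f : density R, holder_ball t x L eta f ->
    (supnorm (fun z => (f z - haar_proj j x f z)%R)
       <= (c t L eta * 2 `^ (- (j%:R * t)))%:E)%E.

(* f_n(j,x) *)
Definition hist (R : realType) (n : nat) (X : n.-tuple R) (j : nat) (x : R) : R :=
  n%:R^-1 * \sum_(i < n) 2 ^+ j * \1_(cell j x) (tnth X i).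

(* The condition defining jhat; it is vacuous at j = jmax, so for J <= jmax
   the filtered sequence in [jhat] is nonempty and increasing, and its head is
   the minimal admissible level. *)
Definition admissible (R : realType) (zeta : R) (jmax n : nat)
    (X : n.-tuple R) (x : R) (j : nat) : bool :=
  all (fun j' => Num.sqrt (n%:R * 2 ^- j') * `|hist X j' x - hist X j x|
                   <= zeta * Num.sqrt (hist X j x))
      (index_iota j.+1 jmax.+1).

Definition jhat (R : realType) (zeta : R) (jmax n : nat) (X : n.-tuple R)
    (J : nat) (x : R) : nat :=
  head jmax [seq j <- index_iota J jmax.+1 | admissible zeta jmax X x j].

Definition fhat (R : realType) (zeta : R) (jmax n : nat) (X : n.-tuple R)
    (J : nat) (x : R) : R :=
  hist X (jhat zeta jmax X J x) x.

(* Since [0^-1 = 0], dividing by [Num.sqrt (hist X j' x)] implements the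
   convention that 1/s_n(j',x) is 0 when f_n(j',x) = 0. *)
Definition prop_stat (R : realType) (zeta : R) (jmax n : nat) (X : n.-tuple R)
    (j : nat) (x : R) : R :=
  \big[Num.max/0]_(j <= j' < jmax.+1)
    (Num.sqrt (n%:R * 2 ^- j' / ln n%:R) *
     `|(fhat zeta jmax X j' x - hist X j' x) / Num.sqrt (hist X j' x)|).

(* The hypothesis I_{jmax,m} `<=` I_{j,k} pins down k = k(m). *)
Definition uniform_propagation (R : realType) (alpha : R)
    (F : nat -> nat -> set (density R)) (jmax : nat -> nat) (zeta : nat -> R) :=
  forall n : nat, (1 < n)%N ->
  forall j : nat, (j <= jmax n)%N ->
  forall m : nat, (m < 2 ^ jmax n)%N ->
  forall k : nat, (k < 2 ^ j)%N ->
    dyadic (jmax n) m `<=` (dyadic j k : set R) ->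
  forall f : density R, F j k f ->
  (\int[Pr f n]_X
     (ereal_sup [set (prop_stat (zeta n) (jmax n) X j x)%:E |
                  x in (dyadic (jmax n) m : set R)]) ^+ 2
     <= (alpha / (n%:R * 2 ^+ (2 * jmax n)))%:E)%E.

Definition Fjk (R : realType) (delta M : R) (j k : nat) : set (density R) :=
  Vjk j k `&`
  [set f | [/\ 0 < delta, (delta%:E <= inf01 f)%E & (supnorm f <= M%:E)%E]].

Definition bounded_away_from_zero (R : realType) (g : R -> R) :=
  exists a b : R, 0 < a /\ forall x : R, 0 < x <= 1 -> a <= g x <= b.

Definition Delta_level (R : realType) (c L t delta : R) (j : nat) : R :=
  c ^+ 2 * (L / delta ^+ 2) * 2 `^ (- (j%:R * (2 * t + 1))).

Definition is_least (A : set nat) (j : nat) :=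
  A j /\ forall i, A i -> (j <= i)%N.

(* Uniform tightness of Z_n, n > 1, each Z_n being a statistic of a sample of
   size n drawn from P n. *)
Definition bounded_in_probability (R : realType)
    (P : forall n, probability (n.-tuple R) R)
    (Z : forall n, n.-tuple R -> \bar R) :=
  forall eps : R, 0 < eps -> exists C : R, forall n, (1 < n)%N ->
    (P n [set X | C%:E < `|Z n X|] <= eps%:E)%E.

(* Main.v *)
(* All statistics depend on the sample only through the dyadic cells of level
   at most jmax that contain the observations, so that every relevant event is a
   finite union of rectangles of the product measure.  Outside an event of
   vanishing probability two things hold.  First, by Chernoff and a union bound
   over the dyadic intervals, |f_n(j,x) - E f_n(j,x)| <= C r_j, where
   r_j = sqrt(2^j log n / n), for all j <= jmax and x.  Second, the propagation
   statistic at level j^*(x) is at most 1 at every x: under the density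
   K_{j^*,x}(f_0) this is the UP condition, and since the likelihood ratio of
   f_0 to it has second moment at most exp(n Delta_{j^*,x}) <= n^Delta,
   Cauchy-Schwarz transfers the bound to f_0 at the cost of a factor n^(Delta/2).
   On this event fhat(x) differs from f_n(j^*(x),x) by O(r_{j^*}), either by
   propagation or by the very definition of jhat, and the definition of j^*(x)
   makes the bias O(r_{j^*}) and r_{j^*} = O((log n / n)^(t(x)/(2t(x)+1))). *)

Require Import Defs.
From HB Require Import structures.
From mathcomp Require Import all_boot all_order all_algebra.
From mathcomp Require Import all_classical all_reals all_analysis.
From mathcomp Require Import measurable_realfun.
From mathcomp Require Import ring lra.

Import Order.TTheory GRing.Theory Num.Theory.
Import numFieldNormedType.Exports.
Local Open Scope classical_set_scope.
Local Open Scope ring_scope.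

(** * Probabilities of events determined by a finite quantizer *)

Definition pr {d} {T : measurableType d} {R : realType} (P : probability T R)
    (A : set T) : R := fine (P A).

Lemma prE {d} {T : measurableType d} {R : realType} (P : probability T R)
    (A : set T) : measurable A -> P A = (pr P A)%:E.
Proof.
by move=> mA; rewrite fineK // fin_num_measure.
Qed.

Lemma pr_ge0 {d} {T : measurableType d} {R : realType} (P : probability T R)
    (A : set T) : 0 <= pr P A.
Proof. exact: fine_ge0. Qed.

Lemma prT {d} {T : measurableType d} {R : realType} (P : probability T R) :
  pr P setT = 1.
Proof. by rewrite /pr probability_setT. Qed.

Lemma pr_le1 {d} {T : measurableType d} {R : realType} (P : probability T R)
    (A : set T) : measurable A -> pr P A <= 1.
Proof. by move=> mA; rewrite -lee_fin -prE// probability_le1. Qed.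

Lemma le_pr {d} {T : measurableType d} {R : realType} (P : probability T R)
    (A B : set T) : measurable A -> measurable B -> A `<=` B -> pr P A <= pr P B.
Proof.
by move=> mA mB AB; rewrite -lee_fin -!prE//; apply: le_measure; rewrite ?inE.
Qed.

Lemma pr_setU_le {d} {T : measurableType d} {R : realType} (P : probability T R)
    (A B : set T) : measurable A -> measurable B ->
  pr P (A `|` B) <= pr P A + pr P B.
Proof.
move=> mA mB; rewrite -lee_fin EFinD -!prE//; last exact: measurableU.
exact: measureU2.
Qed.

Lemma pr_bigsetU_le {d} {T : measurableType d} {R : realType}
    (P : probability T R) {I : Type} (s : seq I) (F : I -> set T) :
  (forall i, measurable (F i)) ->
  pr P (\big[setU/set0]_(i <- s) F i) <= \sum_(i <- s) pr P (F i).
Proof.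
move=> mF; elim: s => [|i s IH]; first by rewrite !big_nil /pr measure0.
rewrite !big_cons.
apply: (@le_trans _ _ (pr P (F i) + pr P (\big[setU/set0]_(i <- s) F i))).
  by apply: pr_setU_le => //; exact: bigsetU_measurable.
by rewrite lerD2l.
Qed.

Lemma fin_preimage {d} {T : measurableType d} {I : finType} (c : T -> I)
    (B : {set I}) : (forall a, measurable (c @^-1` [set a])) ->
  measurable [set y | c y \in B].
Proof.
move=> mc; have -> : [set y | c y \in B] =
    \big[setU/set0]_(a in B) (c @^-1` [set a]).
  by apply/seteqP; split => y /=; rewrite -big_enum -bigcup_seq /=;
    [move=> cB; exists (c y); rewrite //= mem_enum |
     case=> a /=; rewrite mem_enum => aB ->].
exact: bigsetU_measurable.
Qed.

Lemma pr_fin_preimageI {d} {T : measurableType d} {R : realType}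
    (P : probability T R) {I : finType} (c : T -> I) (E : set T) (B : {set I}) :
  measurable E -> (forall a, measurable (c @^-1` [set a])) ->
  pr P (E `&` [set y | c y \in B]) = \sum_(a in B) pr P (E `&` c @^-1` [set a]).
Proof.
move=> mE mc; apply: EFin_inj; rewrite -prE; last first.
  by apply: measurableI => //; exact: fin_preimage.
rewrite -sumEFin.
have -> : E `&` [set y | c y \in B] =
    \bigcup_(a in [set` B]) (E `&` c @^-1` [set a]).
  apply/seteqP; split => y /=; first by case=> Ey cB; exists (c y).
  by case=> a aB [Ey ca]; split => //; rewrite ca.
rewrite measure_fin_bigcup //; last 2 first.
  by apply: trivIset_setIl; exact: trivIset_preimage1.
  by move=> a _; exact: measurableI.
rewrite fsbig_finite//= (perm_big (enum B)).
  by rewrite big_enum/=; apply: eq_bigr => a _; rewrite prE//; exact: measurableI.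
apply: uniq_perm; rewrite ?finmap.fset_uniq ?enum_uniq// => a.
by rewrite in_fset_set// mem_enum; apply/idP/idP; rewrite inE.
Qed.

Lemma pr_fin_preimage {d} {T : measurableType d} {R : realType}
    (P : probability T R) {I : finType} (c : T -> I) (B : {set I}) :
  (forall a, measurable (c @^-1` [set a])) ->
  pr P [set y | c y \in B] = \sum_(a in B) pr P (c @^-1` [set a]).
Proof.
move=> mc; rewrite -[X in pr P X]setTI pr_fin_preimageI//.
by under eq_bigr do rewrite setTI.
Qed.

Lemma sum_pr_preimageI {d} {T : measurableType d} {R : realType}
    (P : probability T R) {I : finType} (c : T -> I) (E : set T) :
  measurable E -> (forall a, measurable (c @^-1` [set a])) ->
  \sum_a pr P (E `&` c @^-1` [set a]) = pr P E.
Proof.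
move=> mE mc; rewrite -[in RHS](setIT E).
have -> : [set: T] = [set y | c y \in [set: I]%SET].
  by apply/seteqP; split => y //=; rewrite inE.
by rewrite pr_fin_preimageI//; apply: eq_bigl => a; rewrite inE.
Qed.

Lemma sum_pr_preimage {d} {T : measurableType d} {R : realType}
    (P : probability T R) {I : finType} (c : T -> I) :
  (forall a, measurable (c @^-1` [set a])) ->
  \sum_a pr P (c @^-1` [set a]) = 1.
Proof.
move=> mc; rewrite -(prT P) -(sum_pr_preimageI P c _ measurableT mc).
by under [RHS]eq_bigr do rewrite setTI.
Qed.

(** The fibers of this coding of a sample are rectangles, so [iid_rect] computes their
    probabilities. *)
Definition quant {T : Type} {I : finType} (c : T -> I) {n : nat}
    (X : n.-tuple T) : {ffun 'I_n -> I} := [ffun i => c (tnth X i)].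

Lemma quant_fiber {T : Type} {I : finType} (c : T -> I) {n : nat}
    (s : {ffun 'I_n -> I}) : quant c (n := n) @^-1` [set s] =
  [set X | forall i, (c @^-1` [set s i]) (tnth X i)].
Proof.
apply/seteqP; split => X /=.
  by move=> <- i; rewrite /quant ffunE.
by move=> Xs; apply/ffunP => i; rewrite /quant ffunE; exact: Xs.
Qed.

Lemma measurable_quant_fiber {d} {T : measurableType d} {I : finType}
    (c : T -> I) {n : nat} (s : {ffun 'I_n -> I}) :
  (forall a, measurable (c @^-1` [set a])) ->
  measurable (quant c (n := n) @^-1` [set s]).
Proof.
move=> mc; rewrite quant_fiber [X in measurable X](_ : _ =
  \big[setI/setT]_(i < n) ((fun X => tnth X i) @^-1` (c @^-1` [set s i]))).
  apply: bigsetI_measurable => i _; rewrite -[X in measurable X]setTI.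
  by apply: measurable_tnth => //; exact: mc.
apply/seteqP; split => X /=; rewrite -bigcap_seq; first by move=> Xs i _; exact: Xs.
by move=> Xs i; apply: (Xs i); rewrite /= mem_index_enum.
Qed.

(** Splitting an event into fibers turns its probability under the product measure into a finite sum
    of products; the change of measure and the exponential moments below are carried out on such
    sums. *)
Lemma pr_quant {d} {T : measurableType d} {R : realType} {I : finType}
    (P : probability T R) (c : T -> I) (n : nat) (B : {set {ffun 'I_n -> I}}) :
  (forall a, measurable (c @^-1` [set a])) ->
  pr (iid P n) [set X | quant c X \in B] =
  \sum_(s in B) \prod_i pr P (c @^-1` [set s i]).
Proof.
move=> mc; rewrite pr_fin_preimage; last by move=> s; exact: measurable_quant_fiber.
apply: eq_bigr => s _; rewrite quant_fiber; apply: EFin_inj.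
have [//|mX PX] := @iid_rect _ _ _ P n (fun i => c @^-1` [set s i]).
by rewrite -prE// PX -prodEFin; apply: eq_bigr => i _; rewrite prE.
Qed.

(** * Change of measure and Chernoff bound *)

(** [x ^+ 2] is the product of [k * y] and [k^-1 * w], so this is the inequality between geometric
    and arithmetic means. *)
Lemma ge0_amgm {R : realFieldType} (x y w k : R) : 0 <= y -> 0 <= w -> 0 < k ->
  x ^+ 2 = w * y -> x <= (k * y + k^-1 * w) / 2.
Proof.
move=> y0 w0 k0 xwy; have kw0 : 0 <= k^-1 * w by rewrite mulr_ge0// invr_ge0 ltW.
have ky0 : 0 <= k * y by rewrite mulr_ge0// ltW.
have : x ^+ 2 = (k * y) * (k^-1 * w).
  by rewrite mulrACA mulfV ?gt_eqF// mul1r mulrC.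
move: (k * y) (k^-1 * w) ky0 kw0 => a b a0 b0 xab.
rewrite ler_pdivlMr// leNgt; apply/negP => abx.
have : (a + b) * (a + b) < (x * 2) * (x * 2) by apply: ltr_pM => //; lra.
by have := sqr_ge0 (a - b); nra.
Qed.

(* Cauchy-Schwarz in its additive form: the weight [k] is free, which avoids
   square roots of the two factors. *)
Lemma change_of_measure_sum {R : realFieldType} {I : finType} (n : nat)
    (p q : I -> R) (k : R) (B : {set {ffun 'I_n -> I}}) :
  (forall a, 0 <= p a) -> (forall a, 0 <= q a) ->
  (forall a, q a = 0 -> p a = 0) -> 0 < k ->
  \sum_(s in B) \prod_i p (s i) <=
  (k * \sum_(s in B) \prod_i q (s i) +
   k^-1 * (\sum_a p a ^+ 2 / q a) ^+ n) / 2.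
Proof.
move=> p0 q0 pq k0.
have w0 a : 0 <= p a ^+ 2 / q a by rewrite divr_ge0// sqr_ge0.
(* Passing from [B] to all codes only adds nonnegative terms, and the full sum factorizes into an
   n-th power. *)
have : \sum_(s in B) \prod_i (p (s i) ^+ 2 / q (s i)) <=
    (\sum_a p a ^+ 2 / q a) ^+ n.
  rewrite -[X in _ ^+ X]card_ord -prodr_const bigA_distr_bigA big_mkcond /=.
  by apply: ler_sum => s _; case: ifP => // _; apply: prodr_ge0.
set S := \sum_(s in B) _ => SX.
apply: (@le_trans _ _ ((k * \sum_(s in B) \prod_i q (s i) + k^-1 * S) / 2)).
  rewrite !mulr_sumr -big_split/= mulr_suml; apply: ler_sum => s _.
  apply: ge0_amgm; rewrite ?prodr_ge0// -prodrXl -big_split/=.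
  apply: eq_bigr => i _; have [qs|qs] := eqVneq (q (s i)) 0.
    by rewrite pq// qs expr0n/= !mul0r.
  by rewrite divfK.
by rewrite ler_pM2r ?invr_gt0// lerD2l ler_pM2l ?invr_gt0.
Qed.

(* The left-hand side is one plus the chi-square divergence of [P] from [Q] on
   the partition induced by [c]. *)
Lemma chi2_sum_le {d} {T : measurableType d} {R : realType}
    (P Q : probability T R) {I : finType} (c : T -> I) (E : set T) (rho : R) :
  measurable E -> (forall a, measurable (c @^-1` [set a])) -> 0 <= rho ->
  (forall A, measurable A -> `|pr P A - pr Q A| <= rho * pr Q (E `&` A)) ->
  \sum_a pr P (c @^-1` [set a]) ^+ 2 / pr Q (c @^-1` [set a]) <=
  1 + rho ^+ 2 * pr Q E.
Proof.
move=> mE mc rho0 PQ; rewrite -(sum_pr_preimageI Q c _ mE mc) mulr_sumr.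
pose p a := pr P (c @^-1` [set a]); pose q a := pr Q (c @^-1` [set a]).
(* Since [p ^+ 2 / q] equals [2 * p - q + (p - q) ^+ 2 / q], only the last term remains to be
   bounded on each fiber. *)
have -> : 1 = \sum_a (2 * p a - q a).
  by rewrite sumrB -mulr_sumr !sum_pr_preimage//; lra.
rewrite -big_split/=; apply: ler_sum => a _.
have := PQ _ (mc a); rewrite -/(p a) -/(q a).
have : pr Q (E `&` c @^-1` [set a]) <= q a.
  by apply: le_pr => //; exact: measurableI.
have := pr_ge0 Q (E `&` c @^-1` [set a]).
have : 0 <= q a := pr_ge0 _ _.
move: (pr Q (E `&` _)) (p a) (q a) => e {}p {}q q0 e0 eq pqe.
have [q00|qn0] := eqVneq q 0.
  move: pqe; have -> : e = 0 by lra.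
  rewrite q00 mulr0 subr0 normr_le0 => /eqP ->.
  by rewrite expr0n /= mul0r !mulr0 subr0 addr0.
have qgt0 : 0 < q by lra.
rewrite ler_pdivrMr//.
have : (p - q) ^+ 2 <= (rho * e) ^+ 2.
  by rewrite -real_normK ?num_real// lerXn2r ?nnegrE// mulr_ge0.
have : (rho * e) ^+ 2 <= rho ^+ 2 * e * q.
  by rewrite exprMn -mulrA ler_wpM2l ?sqr_ge0// expr2 ler_wpM2l.
by nra.
Qed.

(** The set [E] carries the whole difference between [P] and [Q], of relative size at most [rho];
    the n-th power of one plus the chi-square divergence is then bounded by an exponential. *)
Lemma iid_change_of_measure {d} {T : measurableType d} {R : realType}
    (P Q : probability T R) {I : finType} (c : T -> I) (E : set T) (rho k : R)
    (n : nat) (B : {set {ffun 'I_n -> I}}) :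
  measurable E -> (forall a, measurable (c @^-1` [set a])) -> 0 <= rho ->
  (forall A, measurable A -> `|pr P A - pr Q A| <= rho * pr Q (E `&` A)) ->
  0 < k ->
  pr (iid P n) [set X | quant c X \in B] <=
  (k * pr (iid Q n) [set X | quant c X \in B] +
   k^-1 * expR (n%:R * (rho ^+ 2 * pr Q E))) / 2.
Proof.
move=> mE mc rho0 PQ k0; rewrite !pr_quant//.
apply: le_trans (@change_of_measure_sum _ _ n (fun a => pr P (c @^-1` [set a]))
  (fun a => pr Q (c @^-1` [set a])) k B _ _ _ k0) _.
- by move=> a; exact: pr_ge0.
- by move=> a; exact: pr_ge0.
(* The relative bound, applied to a fiber that is null under [Q], shows that it is null under
   [P]. *)
- move=> a qa0; have := PQ _ (mc a).
  have : pr Q (E `&` c @^-1` [set a]) <= pr Q (c @^-1` [set a]).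
    by apply: le_pr => //; exact: measurableI.
  have := pr_ge0 Q (E `&` c @^-1` [set a]); rewrite qa0 => e0 e1.
  have -> : pr Q (E `&` c @^-1` [set a]) = 0 by lra.
  by rewrite mulr0 subr0 normr_le0 => /eqP.
rewrite ler_pM2r ?invr_gt0// lerD2l ler_pM2l ?invr_gt0//.
rewrite expRM_natl lerXn2r ?nnegrE ?expR_ge0//.
  by apply: sumr_ge0 => a _; rewrite divr_ge0 ?sqr_ge0// pr_ge0.
exact: le_trans (chi2_sum_le P Q c E rho mE mc rho0 PQ) (expR_ge1Dx _).
Qed.

(** [expR (- x) >= 1 - x] gives [expR x * (1 - x) <= 1], while [(1 + x + 2 * x ^+ 2) * (1 - x)]
    equals [1 + x ^+ 2 * (1 - 2 * x)], which is at least 1 in this range. *)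
Lemma expR_le_quadratic {R : realType} (x : R) : x <= 1 / 2 ->
  expR x <= 1 + x + 2 * x ^+ 2.
Proof.
move=> x2; have := expR_ge1Dx (- x); rewrite expRN => ex.
have e0 := expR_gt0 x.
have : expR x * (1 - x) <= 1 by rewrite -ler_pdivlMl// mulr1.
move=> {ex}; move: (expR x) e0 => e e0 ex.
have : e * (1 - x) <= (1 + x + 2 * x ^+ 2) * (1 - x) by nra.
by rewrite ler_pM2r//; lra.
Qed.

(** The sign of [l] is left free, so that positive and negative [l] give the upper and the lower
    tail. *)
Lemma binomial_chernoff {d} {T : measurableType d} {R : realType}
    (P : probability T R) (S : set T) (n : nat) (l v : R) :
  measurable S -> l <= 1 / 2 ->
  measurable [set X : n.-tuple T |
    v < l * \sum_(i < n) (\1_S (tnth X i) - pr P S)] /\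
  pr (iid P n) [set X | v < l * \sum_(i < n) (\1_S (tnth X i) - pr P S)] <=
  expR (2 * n%:R * pr P S * l ^+ 2 - v).
Proof.
move=> mS l2; set p := pr P S; pose c y := y \in S.
have c1 : c @^-1` [set true] = S.
  by apply/seteqP; split => y /=; rewrite /c; [move/set_mem|move/mem_set].
have c0 : c @^-1` [set false] = ~` S.
  by apply/seteqP; split => y /=; rewrite /c;
    [move=> /negbT/negP; rewrite in_setE | move=> yS; apply/negbTE/negP; rewrite in_setE].
have mc b : measurable (c @^-1` [set b]).
  by case: b; rewrite ?c1 ?c0//; exact: measurableC.
pose B : {set {ffun 'I_n -> bool}} :=
  [set s : {ffun 'I_n -> bool} | v < l * \sum_(i < n) ((s i)%:R - p)]%SET.
have -> : [set X : n.-tuple T | v < l * \sum_(i < n) (\1_S (tnth X i) - p)] =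
    [set X | quant c X \in B].
  have cE X : \sum_(i < n) (\1_S (tnth X i) - p) =
      \sum_(i < n) ((quant c X i)%:R - p).
    by apply: eq_bigr => i _; rewrite ffunE indicE.
  by apply/seteqP; split => X /=; rewrite inE cE.
split; first by apply: fin_preimage => s; exact: measurable_quant_fiber.
rewrite pr_quant//.
(* Exponentially tilted weights: on [B] their product times [expR (- v)] dominates the original
   product, and over all codes it factorizes. *)
pose q b := pr P (c @^-1` [set b]) * expR (l * (b%:R - p)).
apply: (@le_trans _ _ (\sum_(s : {ffun 'I_n -> bool}) expR (- v) * \prod_i q (s i))).
  rewrite big_mkcond/=; apply: ler_sum => s _; case: ifPn => [|_]; last first.
    by rewrite mulr_ge0 ?expR_ge0 ?prodr_ge0// => i _; rewrite mulr_ge0 ?pr_ge0 ?expR_ge0.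
  rewrite inE => vs; rewrite big_split/= -expR_sum -mulr_sumr mulrCA -expRD.
  apply: ler_peMr; first by apply: prodr_ge0 => i _; exact: pr_ge0.
  by rewrite -[leLHS]expR0 ler_expR addrC subr_ge0 ltW.
rewrite -mulr_sumr -(bigA_distr_bigA (fun _ : 'I_n => q)) prodr_const card_ord.
rewrite big_bool /q c1 -/p.
have -> : pr P (c @^-1` [set false]) = 1 - p.
  have := sum_pr_preimage P c mc; rewrite big_bool c1 -/p => /= <-; lra.
rewrite [leRHS]expRD mulrC ler_pM2r ?expR_gt0//.
rewrite (_ : 2 * n%:R * p * l ^+ 2 = n%:R * (p * (2 * l ^+ 2))); last by ring.
rewrite expRM_natl lerXn2r ?nnegrE ?expR_ge0//.
  by rewrite addr_ge0// mulr_ge0 ?expR_ge0 ?pr_ge0// subr_ge0 pr_le1.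
rewrite mulrBr mulr1 sub0r expRD mulrN -mulrN.
(* This factor is at most [expR (p * (expR l - 1 - l))], and [expR_le_quadratic] bounds the exponent
   by [p * (2 * l ^+ 2)]. *)
rewrite [leLHS](_ : _ = (1 + p * (expR l - 1)) * expR (l * - p)); last first.
  by rewrite /=; ring.
apply: le_trans (ler_wpM2r (expR_ge0 _) (expR_ge1Dx _)) _.
rewrite -expRD ler_expR; have := expR_le_quadratic _ l2; have := pr_ge0 P S.
by rewrite -/p; nra.
Qed.

(** * Dyadic projections of densities *)

Section dyadic_intervals.
Context {R : realType}.
Implicit Types (j k : nat) (x y : R).

Lemma dyadicE j k x : dyadic j k x <-> k%:R < 2 ^+ j * x <= k.+1%:R.
Proof.
have p0 : 0 < 2 ^+ j :> R by rewrite exprn_gt0.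
by rewrite /dyadic /= in_itv /= ltr_pdivrMr // ler_pdivlMr // (mulrC x).
Qed.

Lemma measurable_dyadic j k : measurable (dyadic j k : set R).
Proof. exact: measurable_itv. Qed.

Lemma lebesgue_measure_dyadic j k :
  lebesgue_measure (dyadic j k : set R) = (2 ^- j)%:E.
Proof.
rewrite /dyadic lebesgue_measure_itv /= lte_fin ltr_pM2r ?invr_gt0 ?exprn_gt0//.
by rewrite ltr_nat ltnSn -EFinB -mulrBl -natrB// subSnn mul1r.
Qed.

Lemma dyadic_sub01 j k : (k < 2 ^ j)%N -> dyadic j k `<=` [set x : R | 0 < x <= 1].
Proof.
move=> kj x /dyadicE /andP[kx xk] /=.
have p0 : 0 < 2 ^+ j :> R by rewrite exprn_gt0.
rewrite -(pmulr_rgt0 _ p0) (le_lt_trans _ kx)//=.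
by rewrite -(ler_pM2l p0) mulr1 (le_trans xk)// -natrX ler_nat.
Qed.

Lemma cell_indexPn j x : 0 < x <= 1 ->
  (cell_index j x < 2 ^ j)%N /\ dyadic j (cell_index j x) x.
Proof. by move=> x01; apply/cell_indexP. Qed.

(** After scaling by [2 ^+ j] all endpoints are integers, and the common point [x] forces them into
    the order required. *)
Lemma dyadic_nested i j k l x : (i <= j)%N -> dyadic i k x -> dyadic j l x ->
  dyadic j l `<=` (dyadic i k : set R).
Proof.
move=> ij /dyadicE /andP[kx xk] /dyadicE /andP[lx xl] y /dyadicE /andP[ly yl].
have p0 : 0 < 2 ^+ (j - i) :> R by rewrite exprn_gt0.
have jE : 2 ^+ j = 2 ^+ (j - i) * 2 ^+ i :> R by rewrite -exprD subnK.
have nE m : 2 ^+ (j - i) * m%:R = (2 ^ (j - i) * m)%:R :> R by rewrite natrM natrX.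
move: lx xl ly yl; rewrite jE -!mulrA => lx xl ly yl.
move: kx xk; rewrite -(ltr_pM2l p0) -(ler_pM2l p0) !nE => kx xk.
have := lt_le_trans kx xl; have := lt_le_trans lx xk; rewrite !ltr_nat ltnS => lk kl.
apply/dyadicE; rewrite -(ltr_pM2l p0) -[X in _ && X](ler_pM2l p0) !nE.
by rewrite (le_lt_trans _ ly) ?(le_trans yl) ?ler_nat.
Qed.

Lemma cell_sub01 j x : 0 < x <= 1 -> cell j x `<=` [set x : R | 0 < x <= 1].
Proof. by move=> x01; apply: dyadic_sub01; case: (cell_indexPn j x x01). Qed.

End dyadic_intervals.

Section densities.
Context {R : realType}.
Local Notation mu := (@lebesgue_measure R).
Implicit Types f g h : density R.

Lemma density_prob_le f (A : set R) (b : R) : measurable A ->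
  (forall y, A y -> f y <= b) -> (density_prob f A <= b%:E * mu A)%E.
Proof.
move=> mA fb; rewrite -integral_cst//; apply: ge0_le_integral => //.
- by move=> y _; rewrite lee_fin pdf_ge0.
- by apply/measurable_EFinP; apply: measurable_funTS; exact: measurable_pdf.
Qed.

Lemma density_prob_ge f (A : set R) (b : R) : measurable A -> 0 <= b ->
  (forall y, A y -> b <= f y) -> (b%:E * mu A <= density_prob f A)%E.
Proof.
move=> mA b0 fb; rewrite -integral_cst//; apply: ge0_le_integral => //.
- by apply/measurable_EFinP; apply: measurable_funTS; exact: measurable_pdf.
Qed.

(** A third density [h] appears so that this one-sided bound gives both signs in
    [pr_density_relative], where [h] is the reference density each time. *)
Lemma density_prob_relative f g h (E A : set R) (rho : R) : measurable E ->
  measurable A -> 0 <= rho ->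
  (forall y, E y -> f y <= g y + rho * h y) ->
  (forall y, ~ E y -> f y <= g y) ->
  (density_prob f A <= density_prob g A + rho%:E * density_prob h (E `&` A))%E.
Proof.
move=> mE mA rho0 fE fE'.
have mg (h' : density R) D : measurable_fun D (EFin \o h').
  by apply/measurable_EFinP; apply: measurable_funTS; exact: measurable_pdf.
have g0 (h' : density R) y : (0 <= (h' y)%:E)%E by rewrite lee_fin pdf_ge0.
rewrite /density_prob setIC integral_mkcondr -ge0_integralZl//; last 2 first.
- by apply/measurable_restrict => //; exact: mg.
- by move=> y _; rewrite /patch; case: ifP.
rewrite -ge0_integralD//; last 3 first.
- exact: mg.
- by move=> y _; rewrite mule_ge0// ?lee_fin// /patch; case: ifP.
- apply: measurable_funeM; apply/measurable_restrict => //; exact: mg.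
apply: ge0_le_integral => //.
- exact: mg.
- apply: emeasurable_funD; first exact: mg.
  by apply: measurable_funeM; apply/measurable_restrict => //; exact: mg.
- move=> y _; rewrite /patch; case: ifPn => yE.
    by rewrite -EFinM -EFinD lee_fin fE//; exact: set_mem.
  by rewrite mule0 adde0 lee_fin fE'// => Ey; move/negP: yE; rewrite in_setE.
Qed.

Lemma pr_density_relative f g (E A : set R) (rho : R) : measurable E ->
  measurable A -> 0 <= rho ->
  (forall y, E y -> `|f y - g y| <= rho * g y) ->
  (forall y, ~ E y -> f y = g y) ->
  `|pr (density_prob f) A - pr (density_prob g) A| <=
  rho * pr (density_prob g) (E `&` A).
Proof.
move=> mE mA rho0 fgE fgE'.
have mEA : measurable (E `&` A) by exact: measurableI.
rewrite ler_distlC; apply/andP; split.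
  rewrite lerBlDr -lee_fin EFinD EFinM -!prE//.
  apply: density_prob_relative => // y Ey; last by rewrite fgE'.
  by have := fgE y Ey; rewrite ler_distlC; lra.
rewrite -lee_fin EFinD EFinM -!prE//.
apply: density_prob_relative => // y Ey; last by rewrite fgE'.
by have := fgE y Ey; rewrite ler_distlC; lra.
Qed.

Section haar_density.
Variables (f : density R) (j : nat) (x : R).

Let mcell : measurable (cell j x).
Proof. exact: measurable_dyadic. Qed.

Lemma haar_projE z : haar_proj j x f z =
  if z \in cell j x then 2 ^+ j * pr (density_prob f) (cell j x) else f z.
Proof. by []. Qed.

Let measurable_haar_proj : measurable_fun setT (haar_proj j x f).
Proof.
set a := 2 ^+ j * pr (density_prob f) (cell j x).
rewrite (_ : haar_proj j x f =
    fun z => a * \1_(cell j x) z + f z * \1_(~` cell j x) z); last first.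
  apply/funext => z; rewrite haar_projE -/a !indicE in_setC.
  by case: ifP => _; rewrite ?mulr1 ?mulr0 ?addr0 ?add0r.
apply: measurable_funD; apply: measurable_funM.
- exact: measurable_cst.
- exact: measurable_indic.
- exact: measurable_pdf.
- by apply: measurable_indic; exact: measurableC.
Qed.

Let haar_proj_ge0 z : 0 <= haar_proj j x f z.
Proof. by rewrite haar_projE; case: ifP => _; rewrite ?pdf_ge0// mulr_ge0 ?pr_ge0. Qed.

Let integral_haar_proj : (\int[mu]_z (haar_proj j x f z)%:E = 1)%E.
Proof.
rewrite -(setUv (cell j x)) ge0_integral_setU//=; last 4 first.
- exact: measurableC.
- by apply/measurable_EFinP; apply: measurable_funTS.
- by move=> z _; rewrite lee_fin.
- by apply/disj_setPCl.
rewrite (eq_integral (cst (2 ^+ j * pr (density_prob f) (cell j x))%:E)); last first.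
  by move=> z zI; rewrite haar_projE zI.
rewrite integral_cst// [X in (_ * X)%E]lebesgue_measure_dyadic -EFinM.
rewrite mulrAC mulfV ?expf_neq0//.
have -> : (\int[mu]_(z in ~` cell j x) (haar_proj j x f z)%:E =
    density_prob f (~` cell j x))%E.
  apply: eq_integral => z; rewrite in_setC => /negbTE zI.
  by rewrite haar_projE zI.
rewrite mul1r.
rewrite -prE// -[RHS](probability_setT (density_prob f)) -(setUv (cell j x)).
rewrite measureU// ?setICr//; exact: measurableC.
Qed.

(** Averaging over a cell preserves its mass, so the projection is again a density and samples can
    be drawn from it. *)
Definition haar_density : density R :=
  Density measurable_haar_proj haar_proj_ge0 integral_haar_proj.

End haar_density.

Lemma haar_density_const f j k (x : R) : 0 < x <= 1 -> k = cell_index j x ->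
  forall y, dyadic j k y ->
  haar_density f j x y = 2 ^+ j * pr (density_prob f) (cell j x).
Proof. by move=> x01 -> y yI; rewrite /= haar_projE mem_set. Qed.

Lemma pr_dyadic_le f j k (b : R) : (forall y, dyadic j k y -> f y <= b) ->
  2 ^+ j * pr (density_prob f) (dyadic j k) <= b.
Proof.
move=> fb; have mI := measurable_dyadic j k : measurable (dyadic j k : set R).
have := density_prob_le f _ _ mI fb; rewrite lebesgue_measure_dyadic prE// lee_fin.
by rewrite ler_pdivlMr ?exprn_gt0// mulrC.
Qed.

Lemma pr_dyadic_ge f j k (b : R) : 0 <= b -> (forall y, dyadic j k y -> b <= f y) ->
  b <= 2 ^+ j * pr (density_prob f) (dyadic j k).
Proof.
move=> b0 fb; have mI := measurable_dyadic j k : measurable (dyadic j k : set R).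
have := density_prob_ge f _ _ mI b0 fb; rewrite lebesgue_measure_dyadic prE// lee_fin.
by rewrite ler_pdivrMr ?exprn_gt0// mulrC.
Qed.

Lemma supnormP (h : R -> R) (b : R) :
  (supnorm h <= b%:E)%E <-> forall y, `|h y| <= b.
Proof.
split=> [hb y|hb].
  by rewrite -lee_fin; apply: le_trans hb; apply: ereal_sup_ubound; exists y.
by apply: ge_ereal_sup => _ [y _ <-]; rewrite lee_fin.
Qed.

Lemma inf01P (h : R -> R) (b : R) :
  (b%:E <= inf01 h)%E <-> forall y, 0 < y <= 1 -> b <= h y.
Proof.
split=> [hb y y01|hb].
  by rewrite -lee_fin; apply: le_trans hb _; apply: ereal_inf_lbound; exists y.
by apply: le_ereal_inf_tmp => _ [y y01 <-]; rewrite lee_fin hb.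
Qed.

(** The cell lies in (0,1], so the average of [f] over it inherits the bounds [delta] and [M]; this
    makes the propagation condition applicable to the projection. *)
Lemma haar_density_in f j k (x delta M : R) : 0 < x <= 1 -> 0 < delta ->
  (delta%:E <= inf01 f)%E -> (supnorm f <= M%:E)%E -> k = cell_index j x ->
  Fjk delta M j k (haar_density f j x).
Proof.
move=> x01 d0 /inf01P fd /supnormP fM kE.
have gM : (supnorm (haar_density f j x) <= M%:E)%E.
  apply/supnormP => y; rewrite ger0_norm ?pdf_ge0//= haar_projE.
  case: ifP => _; last by apply: le_trans (fM y); exact: ler_norm.
  by apply: pr_dyadic_le => z _; apply: le_trans (fM z); exact: ler_norm.
split; split => //.
- by apply: le_lt_trans gM _; exact: ltry.
- by exists (2 ^+ j * pr (density_prob f) (cell j x)); exact: haar_density_const.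
- apply/inf01P => y y01 /=; rewrite haar_projE; case: ifP => _; last exact: fd.
  by apply: pr_dyadic_ge; [exact: ltW|move=> z /(cell_sub01 j x x01); exact: fd].
Qed.

(** The projection is at least [delta] on the cell, so a uniform bias [b] is a relative error
    [b / delta]. Confining it to the cell is what later gives the factor [2 ^- j] in the chi-square
    bound. *)
Lemma haar_density_relative f j (x delta b : R) (A : set R) : 0 < x <= 1 ->
  0 < delta -> (delta%:E <= inf01 f)%E ->
  (forall y, `|f y - haar_proj j x f y| <= b) -> measurable A ->
  `|pr (density_prob f) A - pr (density_prob (haar_density f j x)) A| <=
  b / delta * pr (density_prob (haar_density f j x)) (cell j x `&` A).
Proof.
move=> x01 d0 /inf01P fd fb mA.
have b0 : 0 <= b by apply: le_trans (fb 0).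
apply: pr_density_relative => //.
- exact: measurable_dyadic.
- by rewrite divr_ge0// ltW.
- move=> y yI; apply: le_trans (fb y) _; rewrite mulrAC ler_pdivlMr// ler_wpM2l//.
  rewrite /= haar_projE mem_set//.
  by apply: pr_dyadic_ge; [exact: ltW|move=> z /(cell_sub01 j x x01); exact: fd].
- by move=> y yI; rewrite /= haar_projE memNset.
Qed.

Lemma pr_haar_cell_le f j (x b : R) : (forall y, f y <= b) ->
  pr (density_prob (haar_density f j x)) (cell j x) <= b * 2 ^- j.
Proof.
move=> fb; rewrite ler_pdivlMr ?exprn_gt0// mulrC.
apply: pr_dyadic_le => y yI /=; rewrite haar_projE mem_set//.
by apply: pr_dyadic_le => z _.
Qed.

End densities.

(** * Histogram statistics *)

(** An event that depends on the sample only through its code is given by a finite set of codes;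
    both its measurability and the change of measure are obtained this way. *)
Lemma quant_saturated {T : Type} {I : finType} {n : nat} (c : T -> I)
    (A : set (n.-tuple T)) :
  (forall X Y, quant c X = quant c Y -> A X -> A Y) ->
  exists B : {set {ffun 'I_n -> I}}, A = [set X | quant c X \in B].
Proof.
move=> satA; exists [set s : {ffun 'I_n -> I} |
  `[< exists2 X, A X & quant c X = s >]]%SET.
apply/seteqP; split => X /=; rewrite inE.
  by move=> AX; apply/asboolP; exists X.
by move=> /asboolP[Y AY YX]; exact: satA AY.
Qed.

Section histogram_events.
Context {R : realType}.

(** One index range serves all levels. At levels below [J] it includes intervals to the right of 1,
    which do no harm. *)
Definition cells (J : nat) (y : R) : {ffun 'I_J.+1 * 'I_(2 ^ J) -> bool} :=
  [ffun u => y \in dyadic (nat_of_ord u.1) (nat_of_ord u.2)].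

Lemma measurable_cells_fiber J s : measurable (cells J @^-1` [set s]).
Proof.
rewrite (_ : _ @^-1` _ = \big[setI/setT]_(u : 'I_J.+1 * 'I_(2 ^ J))
  (if s u then dyadic u.1 u.2 else ~` dyadic u.1 u.2)).
  apply: bigsetI_measurable => u _; case: ifP => _.
    exact: measurable_dyadic.
  by apply: measurableC; exact: measurable_dyadic.
apply/seteqP; split => y /=.
  move=> <-; rewrite -bigcap_seq => u _ /=; rewrite ffunE.
  by case: ifPn => [/set_mem//|/negP]; rewrite in_setE.
rewrite -bigcap_seq => ys; apply/ffunP => u; have := ys u.
rewrite /= mem_index_enum ffunE => /(_ isT); case: (s u) => [/mem_set//|yN].
by apply/negbTE/negP; rewrite in_setE.
Qed.

Lemma hist_quant (J n : nat) (X Y : n.-tuple R) j x :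
  quant (cells J) X = quant (cells J) Y -> (j <= J)%N -> 0 < x <= 1 ->
  hist X j x = hist Y j x.
Proof.
move=> XY jJ x01; rewrite /hist; congr (_ * _); apply: eq_bigr => i _.
have [kj _] := cell_indexPn j x x01.
have kJ : (cell_index j x < 2 ^ J)%N by rewrite (leq_trans kj)// leq_exp2l.
have := congr1 (fun s : {ffun _ -> {ffun _ -> bool}} =>
  s i (Ordinal (jJ : (j < J.+1)%N), Ordinal kJ)) XY.
by rewrite /quant !ffunE/= !indicE /cell => ->.
Qed.

Lemma jhat_le (zeta : R) (J n : nat) (X : n.-tuple R) j x :
  (jhat zeta J X j x <= J)%N.
Proof.
rewrite /jhat; case E : [seq _ <- _ | _] => [//|i s] /=.
have : i \in [seq j <- index_iota j J.+1 | admissible zeta J X x j].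
  by rewrite E mem_head.
by rewrite mem_filter mem_index_iota ltnS => /and3P[].
Qed.

Lemma fhat_quant (zeta : R) (J n : nat) (X Y : n.-tuple R) j x :
  quant (cells J) X = quant (cells J) Y -> 0 < x <= 1 ->
  fhat zeta J X j x = fhat zeta J Y j x.
Proof.
move=> XY x01; rewrite /fhat (hist_quant J _ X Y)//; last exact: jhat_le.
congr hist; rewrite /jhat; congr head; apply: eq_in_filter => i.
rewrite mem_index_iota ltnS => /andP[_ iJ]; apply: eq_in_all => k.
rewrite mem_index_iota ltnS => /andP[_ kJ].
by rewrite !(hist_quant J _ X Y).
Qed.

Lemma prop_stat_quant (zeta : R) (J n : nat) (X Y : n.-tuple R) j x :
  quant (cells J) X = quant (cells J) Y -> 0 < x <= 1 ->
  prop_stat zeta J X j x = prop_stat zeta J Y j x.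
Proof.
move=> XY x01; rewrite /prop_stat; apply: eq_big_nat => i /andP[_].
by rewrite ltnS => iJ; rewrite (hist_quant J _ X Y)// (fhat_quant _ _ _ X Y).
Qed.

(** Chernoff with parameter [r], the rate itself: the exponent is at most
    [2 * M * ln n - (2 * M + 3) * ln n], so each tail is at most n^-3, enough for a union over n^2
    intervals. The size condition on [n] ensures [r <= 1 / 2]. *)
Lemma hist_deviation (P : probability R R) (n j k : nat) (M : R) :
  (1 < n)%N -> 4 * (2 ^+ j * ln n%:R) <= n%:R :> R ->
  2 ^+ j * pr P (dyadic j k) <= M ->
  let D := [set X : n.-tuple R | (2 * M + 3) * Num.sqrt (2 ^+ j * ln n%:R / n%:R) <
    `|n%:R^-1 * (\sum_(i < n) 2 ^+ j * \1_(dyadic j k) (tnth X i)) -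
      2 ^+ j * pr P (dyadic j k)|] in
  measurable D /\ pr (iid P n) D <= 2 * expR (- (3 * ln n%:R)).
Proof.
move=> n1 jn pM; set p := pr P (dyadic j k) in pM *; set r := Num.sqrt _.
have n0 : 0 < n%:R :> R by rewrite ltr0n ltnW.
have j0 : 0 < 2 ^+ j :> R by rewrite exprn_gt0.
have ln0 : 0 < ln n%:R :> R by rewrite ln_gt0// ltr1n.
have r0 : 0 < r by rewrite sqrtr_gt0 divr_gt0// mulr_gt0.
have r2 : r ^+ 2 = 2 ^+ j * ln n%:R / n%:R.
  by rewrite sqr_sqrtr// ltW// divr_gt0// mulr_gt0.
have rh : r <= 1 / 2.
  have : r ^+ 2 <= 1 / 4 by rewrite r2 ler_pdivrMr//; lra.
  by move: r0; clear; nra.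
move=> D.
pose S (X : n.-tuple R) := \sum_(i < n) (\1_(dyadic j k) (tnth X i) - p).
pose v := (2 * M + 3) * ln n%:R.
have DE : D = [set X | v < r * S X] `|` [set X | v < - r * S X].
  have SE X : n%:R^-1 * (\sum_(i < n) 2 ^+ j * \1_(dyadic j k) (tnth X i)) -
      2 ^+ j * p = n%:R^-1 * 2 ^+ j * S X.
    rewrite /S sumrB sumr_const card_ord -mulr_sumr -mulr_natl.
    by field; rewrite gt_eqF.
  (* Both sides are multiplied by [r * (n / 2 ^+ j)], using that [ln n] equals
     [r ^+ 2 * (n / 2 ^+ j)]. *)
  have vE X : ((2 * M + 3) * r < `|n%:R^-1 * 2 ^+ j * S X|) = (v < `|r * S X|).
    rewrite !normrM (gtr0_norm j0) (gtr0_norm r0) gtr0_norm ?invr_gt0//.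
    rewrite -(ltr_pM2l r0) /v.
    have -> : ln n%:R = r * r * (n%:R / 2 ^+ j).
      by rewrite -expr2 r2; field; rewrite !gt_eqF.
    rewrite -[RHS](ltr_pM2l (_ : 0 < 2 ^+ j / n%:R)) ?divr_gt0//.
    by congr (_ < _); field; rewrite !gt_eqF.
  apply/seteqP; split => X; rewrite /D /= SE vE ?mulNr.
    by rewrite lter_normr => /orP[?|?]; [left|right].
  by move=> [?|?]; rewrite lter_normr; apply/orP; [left|right].
have mI : measurable (dyadic j k : set R) := measurable_dyadic j k.
have [m1 b1] := binomial_chernoff P (dyadic j k) n r v mI rh.
have [|m2 b2] := binomial_chernoff P (dyadic j k) n (- r) v mI; first by lra.
rewrite DE; split; first exact: measurableU.
have bv : 2 * n%:R * p * r ^+ 2 - v <= - (3 * ln n%:R).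
  have -> : 2 * n%:R * p * r ^+ 2 = 2 * (2 ^+ j * p) * ln n%:R.
    by rewrite r2; field; rewrite gt_eqF.
  by rewrite /v; nra.
apply: le_trans (pr_setU_le _ _ _ m1 m2) _; rewrite mulr2n mulrDl mul1r lerD//.
  by apply: le_trans b1 _; rewrite ler_expR.
by apply: le_trans b2 _; rewrite ler_expR sqrrN.
Qed.

End histogram_events.

(** * Transfer of the propagation condition to the true density *)

Section propagation.
Context {R : realType}.

Lemma measurable_saturated (J n : nat) (A : set (n.-tuple R)) :
  (forall X Y, quant (cells J) X = quant (cells J) Y -> A X -> A Y) ->
  measurable A.
Proof.
move=> /quant_saturated[B ->]; apply: fin_preimage => s.
by apply: measurable_quant_fiber; exact: measurable_cells_fiber.
Qed.

Lemma markov_sqr {d} {T : measurableType d} (P : probability T R)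
    (h : T -> \bar R) (b : R) : measurable_fun setT h ->
  (\int[P]_X (h X) ^+ 2 <= b%:E)%E -> pr P [set X | (1 < h X)%E] <= b.
Proof.
move=> mh hb.
have mA : measurable [set X | (1 < h X)%E].
  by have := emeasurable_fun_o_infty measurableT mh 1%E; rewrite setTI.
rewrite -lee_fin -prE//; apply: le_trans hb.
rewrite -[X in (X <= _)%E]mul1e -integral_cst// integral_mkcond.
apply: ge0_le_integral => //.
- by move=> X _; rewrite /patch; case: ifP.
- by apply/(measurable_restrictT (cst 1%E) mA); exact: measurable_cst.
- exact: (emeasurable_funM mh mh).
- move=> X _; rewrite /patch; case: ifPn => [/set_mem/= hX|_]; last exact: sqre_ge0.
  by rewrite -[leLHS]mule1; apply: lee_pmul; rewrite ?lee_fin ?ltW.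
Qed.

(** The propagation condition controls [A] under the projection of [f0], and the change of measure
    carries this over to [f0]. The factor [2 ^- jmax n] pays for the later union over all finest
    cells. *)
Lemma propagation_event (f0 : density R) (M delta alpha : R) (jmax : nat -> nat)
    (zeta : nat -> R) (n j m : nat) (x b L D : R) :
  uniform_propagation alpha (Fjk delta M) jmax zeta ->
  (1 < n)%N -> (j <= jmax n)%N -> (m < 2 ^ jmax n)%N -> dyadic (jmax n) m x ->
  0 < delta -> (delta%:E <= inf01 f0)%E -> (supnorm f0 <= M%:E)%E ->
  (forall y, f0 y <= L) -> (forall y, `|f0 y - haar_proj j x f0 y| <= b) ->
  n%:R * ((b / delta) ^+ 2 * (L * 2 ^- j)) <= D * ln n%:R ->
  let A := [set X | (1 < ereal_sup
    [set (prop_stat (zeta n) (jmax n) X j y)%:E | y in dyadic (jmax n) m])%E] in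
  measurable A /\
  pr (Pr f0 n) A <=
    (alpha + 1) / 2 * (2 ^- jmax n * expR (- ((1 - D) / 2 * ln n%:R))).
Proof.
move=> UP n1 jJ mJ xm d0 fd fM fL fb nD A; set J := jmax n in jJ mJ xm A *.
have x01 : 0 < x <= 1 := dyadic_sub01 _ _ mJ x xm.
have supq (X Y : n.-tuple R) : quant (cells J) X = quant (cells J) Y ->
    ereal_sup [set (prop_stat (zeta n) J X j y)%:E | y in dyadic J m] =
    ereal_sup [set (prop_stat (zeta n) J Y j y)%:E | y in dyadic J m].
  move=> XY; congr ereal_sup; apply: eq_imagel => y ym.
  by rewrite (prop_stat_quant _ _ _ X Y)//; exact: dyadic_sub01 mJ y ym.
have satA (X Y : n.-tuple R) : quant (cells J) X = quant (cells J) Y -> A X -> A Y.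
  by move=> XY; rewrite /A /= (supq X Y).
split; first exact: measurable_saturated satA.
have [B AE] := quant_saturated _ _ satA.
pose g := haar_density f0 j x; pose k := cell_index j x.
have [kj xk] := cell_indexPn j x x01.
have n0 : 0 < n%:R :> R by rewrite ltr0n ltnW.
have gA : pr (Pr g n) A <= alpha / (n%:R * 2 ^+ (2 * J)).
  apply: markov_sqr; last first.
    apply: (UP n n1 j jJ m mJ k kj).
      exact: dyadic_nested xm.
    exact: haar_density_in.
  move=> _ Y mY; rewrite setTI; apply: (measurable_saturated J) => X X' XX' /=.
  by rewrite (supq X X').
(* This weight balances the two terms of the change of measure. *)
pose kappa := 2 ^+ J * expR ((1 + D) / 2 * ln n%:R).
have k0 : 0 < kappa by rewrite mulr_gt0 ?expR_gt0 ?exprn_gt0.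
have b0 : 0 <= b by apply: le_trans (fb 0).
have := @iid_change_of_measure _ _ _ (density_prob f0) (density_prob g) _
  (cells J) (cell j x) (b / delta) kappa n B (measurable_dyadic _ _)
  (measurable_cells_fiber J) (divr_ge0 b0 (ltW d0)) _ k0.
rewrite -/(Pr f0 n) -/(Pr g n) -AE => /(_ _)/le_trans; apply.
  by move=> A' mA'; exact: haar_density_relative.
(* With [eps] equal to n^(-(1-D)/2), the weight [kappa] is [2 ^+ J * n * eps], and n^D is
   n^((1+D)/2) times [eps]. *)
set l := ln n%:R in kappa k0 nD *; set eps := expR (- _).
have nl : expR l = n%:R by rewrite lnK.
have e1 : expR ((1 + D) / 2 * l) = n%:R * eps.
  by rewrite -nl -expRD; congr expR; field.
have e2 : expR (D * l) = expR ((1 + D) / 2 * l) * eps.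
  by rewrite -expRD; congr expR; field.
have eps0 : 0 < eps := expR_gt0 _.
have J0 : 0 < 2 ^+ J :> R by rewrite exprn_gt0.
rewrite [leRHS](_ : _ = (alpha * (2 ^- J * eps) + 2 ^- J * eps) / 2); last first.
  by move: (2 ^- J * eps) => u; field.
rewrite ler_pM2r ?invr_gt0// lerD//.
  apply: le_trans (ler_wpM2l (ltW k0) gA) _.
  rewrite /kappa e1 mul2n -addnn exprD le_eqVlt; apply/orP; left; apply/eqP.
  by field; rewrite !gt_eqF.
rewrite ler_pdivrMl// /kappa mulrACA mulfV ?gt_eqF// mul1r -e2 ler_expR.
apply: le_trans nD; rewrite ler_pM2l// ler_wpM2l ?sqr_ge0//.
exact: pr_haar_cell_le.
Qed.

End propagation.

(** * Rates *)

Section rates.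
Context {R : realType}.

(** The search from level 0 either stops below [j] or reaches [j], from where it agrees with the
    search started there. *)
Lemma jhat_dichotomy (zeta : R) (J n : nat) (X : n.-tuple R) (x : R) (j : nat) :
  (j <= J)%N ->
  (jhat zeta J X 0 x < j)%N && admissible zeta J X x (jhat zeta J X 0 x) \/
  jhat zeta J X 0 x = jhat zeta J X j x.
Proof.
move=> jJ; rewrite /jhat /index_iota subn0.
have -> : iota 0 J.+1 = iota 0 j ++ iota j (J.+1 - j).
  by rewrite -{2}[j]add0n -iotaD subnKC// ltnW.
rewrite filter_cat; case E : [seq i <- iota 0 j | _] => [|i s]; first by right.
left; have : i \in [seq i <- iota 0 j | admissible zeta J X x i].
  by rewrite E mem_head.
by rewrite mem_filter mem_iota/= => /andP[-> ->].
Qed.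

Lemma ln_le_id (x : R) : 0 < x -> ln x <= x.
Proof.
move=> x0; have := @le_ln1Dx R (x - 1).
by rewrite (_ : 1 + (x - 1) = x); [lra|ring].
Qed.

Definition rate (n j : nat) : R := Num.sqrt (2 ^+ j * ln n%:R / n%:R).

Lemma rate_gt0 n j : (1 < n)%N -> 0 < rate n j.
Proof.
move=> n1; rewrite sqrtr_gt0 divr_gt0 ?mulr_gt0 ?exprn_gt0//.
  by rewrite ln_gt0// ltr1n.
by rewrite ltr0n ltnW.
Qed.

Lemma sqr_rate n j : (1 < n)%N -> rate n j ^+ 2 = 2 ^+ j * ln n%:R / n%:R.
Proof.
by move=> n1; rewrite sqr_sqrtr// ltW// -sqrtr_gt0; exact: rate_gt0.
Qed.

(** The propagation statistic is assumed bounded only at some level [i <= j]: it is a maximum over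
    all levels from [i] on, so level [j] is covered. *)
Lemma fhat_error (zeta Cz M C : R) (J n : nat) (X : n.-tuple R) (x y : R) (i j : nat) :
  (1 < n)%N -> (i <= j)%N -> (j <= J)%N ->
  `|zeta| <= Cz * Num.sqrt (ln n%:R) ->
  (forall k, (k <= J)%N -> hist X k x <= M) ->
  0 < hist X j x ->
  prop_stat zeta J X i x <= 1 ->
  `|hist X j x - y| <= C * rate n j ->
  `|fhat zeta J X 0 x - y| <= ((1 + Cz) * Num.sqrt M + C) * rate n j.
Proof.
move=> n1 ij jJ zC hM h0 ps hy.
have n0 : 0 < n%:R :> R by rewrite ltr0n ltnW.
have l0 : 0 < ln n%:R :> R by rewrite ln_gt0// ltr1n.
have j0 : 0 < 2 ^+ j :> R by rewrite exprn_gt0.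
have Cz0 : 0 <= Cz.
  rewrite -(pmulr_lge0 _ (_ : 0 < Num.sqrt (ln n%:R))) ?sqrtr_gt0//.
  exact: le_trans zC.
have sM k : (k <= J)%N -> Num.sqrt (hist X k x) <= Num.sqrt M.
  by move=> /hM; exact: ler_wsqrtr.
suff near : `|fhat zeta J X 0 x - hist X j x| <= (1 + Cz) * Num.sqrt M * rate n j.
  rewrite -(subrKA (hist X j x)); apply: le_trans (ler_normD _ _) _.
  by rewrite mulrDl lerD.
have r0 := rate_gt0 n j n1.
(* If the search stops early at [k < j], admissibility of [k] compares it with level [j]; otherwise
   the estimator is the one started at [j], which the propagation statistic controls. *)
have [/andP[kj /allP /(_ j)]|hatE] := jhat_dichotomy zeta J n X x j jJ.
  rewrite mem_index_iota kj ltnS jJ => /(_ isT).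
  set k := jhat _ _ _ _ _ in kj *; rewrite /fhat -/k distrC => adm.
  have kJ : (k <= J)%N by rewrite (leq_trans _ jJ)// ltnW.
  have {}adm : Num.sqrt (n%:R / 2 ^+ j) * `|hist X k x - hist X j x| <=
      Cz * Num.sqrt (ln n%:R) * Num.sqrt M.
    apply: le_trans adm _; apply: (@le_trans _ _ (`|zeta| * Num.sqrt (hist X k x))).
      by rewrite ler_wpM2r ?sqrtr_ge0// ler_norm.
    by rewrite ler_pM ?sqrtr_ge0// sM.
  have rE : rate n j * Num.sqrt (n%:R / 2 ^+ j) = Num.sqrt (ln n%:R).
    rewrite -sqrtrM; last by rewrite divr_ge0 ?mulr_ge0// ltW.
    by congr Num.sqrt; field; rewrite !gt_eqF.
  have q0 : 0 < Num.sqrt (n%:R / 2 ^+ j) :> R by rewrite sqrtr_gt0 divr_gt0.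
  apply: (@le_trans _ _ (Cz * Num.sqrt M * rate n j)).
    by rewrite -(ler_pM2l q0); apply: le_trans adm _; rewrite -rE; lra.
  by rewrite ler_pM2r// mulrDl mul1r lerDr sqrtr_ge0.
rewrite /fhat hatE -/(fhat zeta J X j x).
have {}ps : Num.sqrt (n%:R * 2 ^- j / ln n%:R) *
    `|(fhat zeta J X j x - hist X j x) / Num.sqrt (hist X j x)| <= 1.
  apply: le_trans ps; rewrite /prop_stat.
  by apply: (bigmax_sup_seq _ j); rewrite ?mem_index_iota ?ij ?ltnS.
set q := Num.sqrt _ in ps.
have qr : q * rate n j = 1.
  rewrite -sqrtrM; last by rewrite ltW// !divr_gt0.
  rewrite (_ : _ * _ = 1) ?sqrtr1//.
  by field; rewrite !gt_eqF.
have s0 : 0 < Num.sqrt (hist X j x) by rewrite sqrtr_gt0.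
move: ps; rewrite normrM normfV (gtr0_norm s0) mulrA ler_pdivrMr// mul1r => ps.
have {}ps : `|fhat zeta J X j x - hist X j x| <= Num.sqrt M * rate n j.
  rewrite -[leLHS]mul1r -qr mulrAC ler_wpM2r ?(ltW r0)//.
  exact: le_trans ps (sM _ jJ).
apply: le_trans ps _; rewrite ler_pM2r// mulrDl mul1r lerDl.
by rewrite mulr_ge0 ?sqrtr_ge0.
Qed.

(** This separates the squared bias factor from the cell length, the form in which the chi-square
    and bias bounds use the level condition. *)
Lemma Delta_levelE (c L t delta : R) (j : nat) :
  Delta_level c L t delta j =
  c ^+ 2 * (L / delta ^+ 2) * ((2 `^ (- (j%:R * t))) ^+ 2 / 2 ^+ j).
Proof.
rewrite /Delta_level; congr (_ * _).
rewrite -powR_mulrn// -powRrM -powR_mulrn// -powRN -powRD; last first.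
  by rewrite pnatr_eq0 implybT.
by congr (_ `^ _); ring.
Qed.

(** Solved for the squared bias, the level condition bounds it by [delta * (D * (delta / L))] times
    the squared rate, and both [D] and [delta / L] are at most 1. *)
Lemma bias_le_rate (c t L delta D : R) (n j : nat) :
  (1 < n)%N -> 0 < delta -> delta <= L -> 0 < D < 1 -> 0 <= c ->
  n%:R * Delta_level c L t delta j <= D * ln n%:R ->
  c * 2 `^ (- (j%:R * t)) <= Num.sqrt delta * rate n j.
Proof.
move=> n1 d0 dL /andP[D0 D1] c0 lev.
have n0 : 0 < n%:R :> R by rewrite ltr0n ltnW.
have l0 : 0 < ln n%:R :> R by rewrite ln_gt0// ltr1n.
have j0 : 0 < 2 ^+ j :> R by rewrite exprn_gt0.
have L0 : 0 < L by apply: lt_le_trans dL.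
have r0 := rate_gt0 n j n1.
have s0 : 0 <= 2 `^ (- (j%:R * t)) :> R := powR_ge0 _ _.
rewrite -(@ler_pXn2r _ 2)// ?nnegrE ?mulr_ge0 ?sqrtr_ge0 ?(ltW r0)//.
rewrite !exprMn sqr_rate// (sqr_sqrtr (ltW d0)).
move: lev; rewrite Delta_levelE; set s := (2 `^ _) ^+ 2 => lev.
have dd : 0 < delta ^+ 2 / L / n%:R * 2 ^+ j by rewrite mulr_gt0// !divr_gt0// exprn_gt0.
have := ler_wpM2l (ltW dd) lev.
have -> : delta ^+ 2 / L / n%:R * 2 ^+ j *
    (n%:R * (c ^+ 2 * (L / delta ^+ 2) * (s / 2 ^+ j))) = c ^+ 2 * s.
  by field; rewrite !gt_eqF.
move=> /le_trans; apply.
have -> : delta ^+ 2 / L / n%:R * 2 ^+ j * (D * ln n%:R) =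
  (delta * (D * (delta / L))) * (2 ^+ j * ln n%:R / n%:R).
  by field; rewrite !gt_eqF.
apply: ler_wpM2r; first by rewrite divr_ge0 ?mulr_ge0 ?(ltW l0) ?(ltW j0).
have dL1 : delta / L <= 1 by rewrite ler_pdivrMr// mul1r.
rewrite ger_pMr// mulr_ile1 ?(ltW D0) ?(ltW D1)//.
by rewrite divr_ge0 ?(ltW d0) ?(ltW L0).
Qed.

(** By minimality level [j - 1] violates the condition, which bounds [2 ^+ j] by [2 * A] times (n /
    log n)^(1/(2t+1)); the power of n / log n then cancels in the squared rate. *)
Lemma rate_normalized (c t L delta D A : R) (n j J : nat) :
  (1 < n)%N -> 0 < t -> 1 <= A -> 0 < D -> c ^+ 2 * (L / delta ^+ 2) <= A * D ->
  is_least [set j | (j <= J)%N /\ n%:R * Delta_level c L t delta j <= D * ln n%:R] j ->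
  (n%:R / ln n%:R) `^ (t / (2 * t + 1)) * rate n j <= Num.sqrt (2 * A).
Proof.
move=> n1 t0 A1 D0 cA [[jJ _] jmin].
have n0 : 0 < n%:R :> R by rewrite ltr0n ltnW.
have l0 : 0 < ln n%:R :> R by rewrite ln_gt0// ltr1n.
have j0 : 0 < 2 ^+ j :> R by rewrite exprn_gt0.
set q := n%:R / ln n%:R; have q0 : 0 < q by rewrite divr_gt0.
have q1 : 1 <= q.
  by rewrite ler_pdivlMr// mul1r ln_le_id.
set s := 2 * t + 1; have s0 : 0 < s by rewrite /s; lra.
have A0 : 0 < A by lra.
have q1s : 1 <= q `^ s^-1 by rewrite -(powRr0 q) ler_powR// invr_ge0 ltW.
have jA : 2 ^+ j <= 2 * A * q `^ s^-1.
  (* At [j = 0] there is no preceding level, and the bound holds because [A] and [q] are at least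
     1. *)
  case: j jJ jmin j0 => [|i] jJ jmin j0; first by rewrite expr0; nra.
  have : ~ (n%:R * Delta_level c L t delta i <= D * ln n%:R).
    by move=> Hi; have := jmin i (conj (ltnW jJ) Hi); rewrite ltnn.
  move=> /negP; rewrite -ltNge /Delta_level -/s => lev.
  have p0 : 0 < 2 `^ (- (i%:R * s)) :> R by rewrite powR_gt0.
  have {}lev : D * ln n%:R < n%:R * (A * D * 2 `^ (- (i%:R * s))).
    by apply: lt_le_trans lev _; rewrite ler_pM2l// ler_pM2r.
  have is_le : 2 `^ (i%:R * s) <= A * q.
    rewrite powRN in lev p0.
    have p0' : 0 < 2 `^ (i%:R * s) :> R by rewrite powR_gt0.
    rewrite /q mulrA ler_pdivlMr//.
    rewrite -(ler_pM2l D0); move: lev; rewrite !mulrA ltr_pdivlMr// => lev; lra.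
  have iA : 2 ^+ i <= A * q `^ s^-1.
    have -> : 2 ^+ i = (2 `^ (i%:R * s)) `^ s^-1 :> R.
      by rewrite -powRrM mulfK ?gt_eqF// powR_mulrn.
    apply: (@le_trans _ _ ((A * q) `^ s^-1)).
      apply: ge0_ler_powR is_le; rewrite ?nnegrE ?powR_ge0 ?invr_ge0 ?(ltW s0)//.
      by rewrite mulr_ge0 ?(ltW A0) ?(ltW q0).
    rewrite powRM ?(ltW A0) ?(ltW q0)// ler_pM2r ?powR_gt0//.
    rewrite -[leRHS]powRr1 ?(ltW A0)//; apply: ler_powR => //.
    by rewrite invf_le1// /s; lra.
  by rewrite exprS -mulrA ler_pM2l.
rewrite -(@ler_pXn2r _ 2)// ?nnegrE ?mulr_ge0 ?sqrtr_ge0 ?powR_ge0//.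
rewrite exprMn sqr_rate// sqr_sqrtr ?mulr_ge0 ?(ltW A0)//.
have -> : 2 ^+ j * ln n%:R / n%:R = 2 ^+ j / q by rewrite /q; field; rewrite !gt_eqF.
rewrite mulrA ler_pdivrMr//.
have qE : q `^ (t / s) ^+ 2 * q `^ s^-1 = q.
  rewrite -powR_mulrn ?powR_ge0// -powRrM -powRD; last by rewrite (gt_eqF q0) implybT.
  rewrite -[RHS]powRr1 ?(ltW q0)//; congr (_ `^ _).
  by rewrite /s; field; rewrite -/s gt_eqF.
have -> : 2 * A * q = q `^ (t / s) ^+ 2 * (2 * A * q `^ s^-1).
  by rewrite -[in LHS]qE; ring.
by rewrite ler_pM2l// exprn_gt0// powR_gt0.
Qed.

End rates.

(** * The exceptional event *)

(** The exceptional set is a finite union: one deviation event per dyadic interval coded by [cells],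
    one propagation event per finest cell. Outside it the error bound holds at all [x] at once. *)
Lemma bad_event {R : realType} (f0 : density R) (M delta alpha : R)
    (jmax : nat -> nat) (zeta : nat -> R) (t L eta : R -> R) (c : R -> R -> R -> R)
    (D Cz A : R) (n : nat) (jst : R -> nat) :
  (supnorm f0 <= M%:E)%E -> 0 < delta -> (delta%:E <= inf01 f0)%E ->
  0 < alpha -> uniform_propagation alpha (Fjk delta M) jmax zeta ->
  (forall x, 0 < x <= 1 -> [/\ 0 < t x, t x <= 1, 0 < L x & 0 < eta x]) ->
  (forall x, 0 < x <= 1 -> holder_ball (t x) x (L x) (eta x) f0) ->
  haar_bias_constant c -> 0 < D < 1 ->
  (1 < n)%N -> `|zeta n| <= Cz * Num.sqrt (ln n%:R) -> 1 <= ln n%:R :> R ->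
  4 * (2 ^+ jmax n * ln n%:R) <= n%:R :> R ->
  (2 * M + 3) * rate n (jmax n) < delta ->
  1 <= A ->
  (forall x, 0 < x <= 1 ->
    c (t x) (L x) (eta x) ^+ 2 * (L x / delta ^+ 2) <= A * D) ->
  (forall x, 0 < x <= 1 -> is_least [set j | (j <= jmax n)%N /\
     n%:R * Delta_level (c (t x) (L x) (eta x)) (L x) (t x) delta j
       <= D * ln n%:R] (jst x)) ->
  exists Bad : set (n.-tuple R), [/\ measurable Bad,
    pr (Pr f0 n) Bad <= (2 + (alpha + 1) / 2) * expR (- ((1 - D) / 2 * ln n%:R)) &
    forall X, ~ Bad X -> forall x, 0 < x <= 1 ->
      (n%:R / ln n%:R) `^ (t x / (2 * t x + 1)) *
        `|fhat (zeta n) (jmax n) X 0 x - f0 x| <=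
      ((1 + Cz) * Num.sqrt (M + delta) + ((2 * M + 3) + Num.sqrt delta)) *
        Num.sqrt (2 * A)].
Proof.
move=> fM d0 fd a0 UP tLe f0H cP /andP[D0 D1] n1 zC l1 nJ rJ A1 cA jstP.
set J := jmax n in nJ rJ jstP *.
have n0 : 0 < n%:R :> R by rewrite ltr0n ltnW.
have l0 : 0 < ln n%:R :> R by apply: lt_le_trans l1.
have /supnormP fMy := fM; have /inf01P fdy := fd.
have fM' y : f0 y <= M by apply: le_trans (fMy y); exact: ler_norm.
have M0 : 0 < M by apply: lt_le_trans d0 (le_trans (fdy 1 _) (fM' 1)); rewrite ltr01 lexx.
pose C1 := 2 * M + 3; have C10 : 0 < C1 by rewrite /C1; lra.
pose cx x := c (t x) (L x) (eta x).
have bias x j : 0 < x <= 1 ->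
    forall y, `|f0 y - haar_proj j x f0 y| <= cx x * 2 `^ (- (j%:R * t x)).
  move=> x01; apply/supnormP; have [t0 t1 L0 e0] := tLe x x01.
  by apply: cP (f0H x x01); rewrite ?t0.
have c0 x : 0 < x <= 1 -> 0 <= cx x.
  move=> x01; have := le_trans (normr_ge0 _) (bias x 0 x01 0).
  by rewrite pmulr_lge0// powR_gt0.
have fL x y : 0 < x <= 1 -> f0 y <= L x.
  move=> x01; have := f0H x x01; rewrite /holder_ball/= ge_max => /andP[/supnormP fL _].
  by apply: le_trans (fL y); exact: ler_norm.
have rateJ j : (j <= J)%N -> C1 * rate n j < delta.
  move=> jJ; apply: le_lt_trans rJ; rewrite ler_pM2l//; apply: ler_wsqrtr.
  by rewrite ler_pM2r ?invr_gt0// ler_pM2r// ler_weXn2l// ler1n.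
have nj j : (j <= J)%N -> 4 * (2 ^+ j * ln n%:R) <= n%:R :> R.
  move=> jJ; apply: le_trans nJ; rewrite ler_pM2l// ler_pM2r//.
  by rewrite ler_weXn2l// ler1n.
(* Each finest cell has a point minimizing [jst], since levels are naturals. A propagation event at
   this minimal level covers every point of the cell, so finitely many events suffice. *)
have xmin (m : 'I_(2 ^ J)) : exists x, dyadic J m x /\
    forall y, dyadic J m y -> (jst x <= jst y)%N.
  have : exists i, `[< exists2 x : R, dyadic J m x & jst x = i >].
    exists (jst (m.+1%:R / 2 ^+ J)); apply/asboolP; exists (m.+1%:R / 2 ^+ J) => //.
    by apply/dyadicE; rewrite mulrC divfK ?expf_neq0// ltr_nat ltnSn lexx.
  move=> /ex_minnP[i /asboolP[x xm <-] imin]; exists x; split=> // y ym.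
  by apply: imin; apply/asboolP; exists y.
have [xm xmP] := choice xmin.
have xm01 m : 0 < xm m <= 1.
  by have [xmm _] := xmP m; exact: dyadic_sub01 (ltn_ord m) _ xmm.
pose Dev (u : 'I_J.+1 * 'I_(2 ^ J)) := [set X : n.-tuple R |
  C1 * Num.sqrt (2 ^+ u.1 * ln n%:R / n%:R) <
  `|n%:R^-1 * (\sum_(i < n) 2 ^+ u.1 * \1_(dyadic u.1 u.2) (tnth X i)) -
    2 ^+ u.1 * pr (density_prob f0) (dyadic u.1 u.2)|].
have DevP u : measurable (Dev u) /\ pr (Pr f0 n) (Dev u) <= 2 * expR (- (3 * ln n%:R)).
  have uJ : (u.1 <= J)%N by rewrite -ltnS.
  apply: (@hist_deviation _ (density_prob f0) n u.1 u.2 M n1 (nj _ uJ)).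
  by apply: pr_dyadic_le => y _.
pose PropE (m : 'I_(2 ^ J)) := [set X : n.-tuple R | (1 < ereal_sup
  [set (prop_stat (zeta n) J X (jst (xm m)) y)%:E | y in dyadic J m])%E].
have PropP m : measurable (PropE m) /\ pr (Pr f0 n) (PropE m) <=
    (alpha + 1) / 2 * (2 ^- J * expR (- ((1 - D) / 2 * ln n%:R))).
  have [xmm _] := xmP m; have [[jJ lev] _] := jstP _ (xm01 m).
  apply: (@propagation_event _ f0 M delta alpha jmax zeta n _ m (xm m) _ _ D UP n1
    jJ (ltn_ord m) xmm d0 fd fM
    (fun y => fL _ y (xm01 m)) (bias _ _ (xm01 m))).
  apply: le_trans lev; rewrite Delta_levelE -/(cx _) le_eqVlt; apply/orP; left.
  by apply/eqP; field; rewrite !gt_eqF// exprn_gt0.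
pose BadD := \big[setU/set0]_u Dev u; pose BadP := \big[setU/set0]_m PropE m.
have mBadD : measurable BadD by apply: bigsetU_measurable => u _; case: (DevP u).
have mBadP : measurable BadP by apply: bigsetU_measurable => u _; case: (PropP u).
exists (BadD `|` BadP); split.
- exact: measurableU.
- apply: le_trans (pr_setU_le _ _ _ mBadD mBadP) _.
  set eps := expR _; have eps0 : 0 < eps := expR_gt0 _.
  rewrite mulrDl lerD//.
    apply: le_trans (pr_bigsetU_le _ _ _ (fun u => (DevP u).1)) _.
    apply: le_trans (ler_sum _ (fun u _ => (DevP u).2)) _.
    rewrite sumr_const card_prod !card_ord -[leLHS]mulr_natl natrM mulrCA.
    rewrite ler_pM2l//.
    have Jn : (2 ^ J)%N%:R <= n%:R :> R.
      apply: le_trans nJ; rewrite natrX mulrCA ler_peMr ?exprn_ge0//.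
      by move: l1; clear; lra.
    have J1n : J.+1%:R <= n%:R :> R.
      by apply: le_trans Jn; rewrite ler_nat ltn_expl.
    (* At most n^2 intervals, each contributing n^-3 up to the factor 2, leave 1/n, which is below
       [eps]. *)
    apply: (@le_trans _ _ (n%:R * n%:R * expR (- (3 * ln n%:R)))).
      by rewrite ler_pM2r ?expR_gt0// ler_pM.
    rewrite -[X in X * X]lnK// -!expRD ler_expR; move: D0 l0; clear; nra.
  apply: le_trans (pr_bigsetU_le _ _ _ (fun u => (PropP u).1)) _.
  apply: le_trans (ler_sum _ (fun u _ => (PropP u).2)) _.
  rewrite sumr_const card_ord -[leLHS]mulr_natl natrX -/eps mulrCA.
  by rewrite (mulrA (2 ^+ J)) mulfV ?mul1r// expf_neq0.
move=> X XBad x x01.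
have nD u : ~ Dev u X.
  move=> Xu; apply: XBad; left; rewrite /BadD -bigcup_seq.
  by exists u; rewrite //= mem_index_enum.
have nP m : ~ PropE m X.
  move=> Xu; apply: XBad; right; rewrite /BadP -bigcup_seq.
  by exists m; rewrite //= mem_index_enum.
have dev k : (k <= J)%N -> `|hist X k x -
    2 ^+ k * pr (density_prob f0) (cell k x)| <= C1 * rate n k.
  move=> kJ; have [ck _] := cell_indexPn k x x01.
  have cJ : (cell_index k x < 2 ^ J)%N by rewrite (leq_trans ck)// leq_exp2l.
  by have /negP := nD (Ordinal (kJ : (k < J.+1)%N), Ordinal cJ); rewrite -leNgt.
have [[jJ lev] jmin] := jstP x x01; set j := jst x in jJ lev jmin.
have [t0 t1 L0 e0] := tLe x x01.
have r0 : 0 < rate n j :> R := rate_gt0 n j n1.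
have [mJ xmJ] := cell_indexPn J x x01.
pose m := Ordinal mJ; have [_ xmmin] := xmP m.
have := @fhat_error _ (zeta n) Cz (M + delta) (C1 + Num.sqrt delta) J n X x (f0 x)
  (jst (xm m)) j n1 (xmmin x xmJ) jJ zC.
(* Deviations below [delta] keep every histogram value under [M + delta] and, as the mean is at
   least [delta], positive at level [j]; the convention for 1/s_n at 0 is thus avoided there. *)
have hM k : (k <= J)%N -> hist X k x <= M + delta.
  move=> kJ; have := dev k kJ; have := rateJ k kJ; rewrite ler_distl => ? /andP[_ ?].
  have : 2 ^+ k * pr (density_prob f0) (cell k x) <= M by apply: pr_dyadic_le => y _.
  lra.
have h0 : 0 < hist X j x.
  have := dev j jJ; have := rateJ j jJ; rewrite ler_distl => ? /andP[? _].
  have : delta <= 2 ^+ j * pr (density_prob f0) (cell j x).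
    by apply: pr_dyadic_ge; [exact: ltW|move=> y /(cell_sub01 j x x01); exact: fdy].
  lra.
have ps : prop_stat (zeta n) J X (jst (xm m)) x <= 1.
  have /negP := nP m; rewrite -leNgt -lee_fin; apply: le_trans.
  by apply: ereal_sup_ubound; exists x.
have hf : `|hist X j x - f0 x| <= (C1 + Num.sqrt delta) * rate n j.
  rewrite -(subrKA (2 ^+ j * pr (density_prob f0) (cell j x))).
  apply: le_trans (ler_normD _ _) _; rewrite mulrDl lerD ?dev//.
  apply: (@le_trans _ _ (cx x * 2 `^ (- (j%:R * t x)))).
    have := bias x j x01 x; rewrite haar_projE mem_set 1?distrC//.
    by have [_] := cell_indexPn j x x01.
  apply: (bias_le_rate _ _ (L x) _ D _ _ n1 d0 _ _ (c0 x x01) lev); last by rewrite D0.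
  by apply: le_trans (fdy 1 _) (fL x 1 x01); rewrite ltr01 lexx.
move=> /(_ hM h0 ps hf) err.
apply: le_trans (ler_wpM2l (powR_ge0 _ _) err) _.
rewrite mulrCA ler_wpM2l//.
  by rewrite -(pmulr_lge0 _ r0); exact: le_trans (normr_ge0 _) err.
exact: (rate_normalized _ _ _ _ _ _ _ _ _ n1 t0 A1 D0 (cA x x01) (jstP x x01)).
Qed.

(** * Crude bounds and boundedness in probability *)

Lemma hist_ge0 {R : realType} {n : nat} (X : n.-tuple R) j x : 0 <= hist X j x.
Proof.
rewrite mulr_ge0 ?invr_ge0//; apply: sumr_ge0 => i _.
by rewrite mulr_ge0 ?exprn_ge0 ?indicE.
Qed.

Lemma hist_le {R : realType} {n : nat} (X : n.-tuple R) j x :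
  (0 < n)%N -> hist X j x <= 2 ^+ j.
Proof.
move=> n0; rewrite ler_pdivrMl ?ltr0n//.
apply: (@le_trans _ _ (\sum_(i < n) 2 ^+ j)).
  by apply: ler_sum => i _; rewrite ler_piMr ?exprn_ge0// indicE lern1 leq_b1.
by rewrite sumr_const card_ord -[leLHS]mulr_natl.
Qed.

Lemma abse_ereal_sup_le {R : realType} {T : Type} (S : set T) (v : T -> R) (b : R) :
  S !=set0 -> (forall x, S x -> 0 <= v x <= b) ->
  (`|ereal_sup [set (v x)%:E | x in S]| <= b%:E)%E.
Proof.
move=> [x Sx] vb; rewrite gee0_abs.
  apply: ge_ereal_sup => _ [y Sy <-]; rewrite lee_fin.
  by have /andP[] := vb y Sy.
apply: (@le_trans _ _ (v x)%:E); first by rewrite lee_fin; have /andP[] := vb x Sx.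
by apply: ereal_sup_ubound; exists x.
Qed.

Lemma expRN_le {R : realType} (b a eps l : R) : 0 < b -> 0 < a -> 0 < eps ->
  b / (a * eps) <= l -> b * expR (- (a * l)) <= eps.
Proof.
move=> b0 a0 e0; rewrite ler_pdivrMr ?mulr_gt0// => bl.
rewrite expRN ler_pdivrMr ?expR_gt0//.
by have := expR_ge1Dx (a * l); nra.
Qed.

Lemma ln_unbounded {R : realType} (K : R) :
  exists N : nat, forall n, (N <= n)%N -> K <= ln n%:R.
Proof.
exists (Num.truncn (expR K)).+1 => n Nn; rewrite -[K]expRK ler_ln ?posrE ?expR_gt0//.
  by rewrite ltW// (lt_le_trans (truncnS_gt _))// ler_nat.
by rewrite ltr0n (leq_trans _ Nn).
Qed.

Theorem theorem3 (R : realType) (f0 : density R) (M delta : R)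
  (f0_bounded : (supnorm f0 <= M%:E)%E)
  (delta_gt0 : 0 < delta)
  (f0_inf : (delta%:E <= inf01 f0)%E)
  (jmax : nat -> nat) (d : R) (d_gt0 : 0 < d)
  (jmaxP : forall n : nat, (1 < n)%N ->
     d * ln n%:R ^+ 2 / n%:R <= 2 ^- jmax n :> R)
  (zeta : nat -> R)
  (zetaO : zeta =O_\oo (fun n => Num.sqrt (ln n%:R)))
  (alpha : R) (alpha_gt0 : 0 < alpha)
  (UP : uniform_propagation alpha (Fjk delta M) jmax zeta)
  (t L eta : R -> R)
  (t_bnd : bounded_away_from_zero t)
  (t_le1 : forall x : R, 0 < x <= 1 -> t x <= 1)
  (L_bnd : bounded_away_from_zero L)
  (eta_bnd : bounded_away_from_zero eta)
  (f0_holder : forall x : R, 0 < x <= 1 ->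
     holder_ball (t x) x (L x) (eta x) f0)
  (c : R -> R -> R -> R)
  (cP : haar_bias_constant c)
  (Delta : R) (Delta_bnd : 0 < Delta < 1 / 2)
  (jstar : nat -> R -> nat)
  (jstarP : \forall n \near \oo, forall x : R, 0 < x <= 1 ->
     is_least [set j | (j <= jmax n)%N /\
        n%:R * Delta_level (c (t x) (L x) (eta x)) (L x) (t x) delta j
          <= Delta * ln n%:R]
       (jstar n x)) :
  bounded_in_probability (Pr f0)
    (fun n X => ereal_sup
       [set ((n%:R / ln n%:R) `^ (t x / (2 * t x + 1)) *
             `|fhat (zeta n) (jmax n) X 0 x - f0 x|)%:E | x in [set x : R | 0 < x <= 1]]).
Proof.
have /supnormP fM := f0_bounded; have /inf01P fd := f0_inf.
have fM' y : f0 y <= M by apply: le_trans (fM y); exact: ler_norm.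
have M0 : 0 < M.
  by apply: lt_le_trans delta_gt0 (le_trans (fd 1 _) (fM' 1)); rewrite ltr01 lexx.
have [ta [tb [ta0 tP]]] := t_bnd; have [La [Lb [La0 LP]]] := L_bnd.
have [ea [eb [ea0 eP]]] := eta_bnd.
have tLe x : 0 < x <= 1 -> [/\ 0 < t x, t x <= 1, 0 < L x & 0 < eta x].
  move=> x01; split; last 2 first.
  - by have /andP[+ _] := LP x x01; exact: lt_le_trans.
  - by have /andP[+ _] := eP x x01; exact: lt_le_trans.
  - by have /andP[+ _] := tP x x01; exact: lt_le_trans.
  - exact: t_le1.
have /eqO_exP[Cz Cz0 [N1 _ zN]] := zetaO.
have [N2 _ jN] := jstarP.
have [D0 D2] := andP Delta_bnd; have D1 : Delta < 1 by lra.
pose n1 := maxn N2 2; pose A : R := 2 ^+ (3 * jmax n1).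
have A1 : 1 <= A by rewrite exprn_ege1// ler1n.
(* The mere existence of [jstar] at a single sample size makes
   [c (t x) (L x) (eta x)] bounded in [x]. *)
have cA x : 0 < x <= 1 ->
    c (t x) (L x) (eta x) ^+ 2 * (L x / delta ^+ 2) <= A * Delta.
  move=> x01; have [t0 t1 _ _] := tLe x x01.
  have [[jJ lev] _] := jN n1 (leq_maxl _ _) x x01.
  set j := jstar n1 x in jJ lev.
  have n10 : 0 < n1%:R :> R by rewrite ltr0n (leq_trans _ (leq_maxr _ _)).
  have := le_trans lev (ler_wpM2l (ltW D0) (ln_le_id _ n10)).
  rewrite mulrC ler_pM2r// /Delta_level powRN ler_pdivrMr ?powR_gt0// => cD.
  apply: le_trans cD _; rewrite mulrC ler_pM2r// /A -powR_mulrn//.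
  apply: ler_powR; first by rewrite ler1n.
  (* The level is at most [jmax n1] and [2 * t x + 1] at most 3, whence the exponent in [A]. *)
  rewrite mulnC natrM; apply: ler_pM; rewrite ?ler_nat//; lra.
pose C1 := 2 * M + 3; have C10 : 0 < C1 by rewrite /C1; lra.
(* A deterministic bound on the statistic. A single constant must serve all [n > 1], so the sum of
   these bounds handles the finitely many small [n]; the absolute value keeps every summand
   nonnegative. *)
pose b n : R := `|n%:R / ln n%:R * (2 ^+ jmax n + M)|.
pose K0 := ((1 + Cz) * Num.sqrt (M + delta) + (C1 + Num.sqrt delta)) *
  Num.sqrt (2 * A).
have K00 : 0 <= K0.
  by rewrite mulr_ge0 ?addr_ge0 ?mulr_ge0 ?sqrtr_ge0// ?addr_ge0// ltW.
move=> eps eps0.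
pose Cp := 2 + (alpha + 1) / 2; have Cp0 : 0 < Cp by rewrite /Cp; lra.
pose a := (1 - Delta) / 2; have a0 : 0 < a by rewrite /a; lra.
(* Thresholds for [ln n]: [T1] gives [4 * 2 ^+ jmax n * ln n <= n], [T2] makes the finest deviation
   smaller than [delta], and [T3] brings the exceptional probability below [eps]. *)
pose T1 := 4 / d; have T10 : 0 < T1 by rewrite divr_gt0.
pose T2 := C1 ^+ 2 / (d * delta ^+ 2).
have T20 : 0 < T2 by apply: divr_gt0; rewrite ?mulr_gt0 ?exprn_gt0.
pose T3 := Cp / (a * eps); have T30 : 0 < T3 := divr_gt0 Cp0 (mulr_gt0 a0 eps0).
have [N3 lN] := ln_unbounded (1 + T1 + T2 + T3).
pose N := maxn N1 (maxn N2 N3).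
exists (K0 + \sum_(i < N) b i) => n n_gt1.
have sb0 : 0 <= \sum_(i < N) b i by rewrite sumr_ge0// => i _; exact: normr_ge0.
pose Z (X : n.-tuple R) x := (n%:R / ln n%:R) `^ (t x / (2 * t x + 1)) *
  `|fhat (zeta n) (jmax n) X 0 x - f0 x|.
have Z0 X x : 0 <= Z X x by rewrite mulr_ge0 ?powR_ge0.
pose E := [set X : n.-tuple R | ((K0 + \sum_(i < N) b i)%:E <
  `|ereal_sup [set (Z X x)%:E | x in [set x : R | (0 < x <= 1)%R]]|)%E].
rewrite -/E.
have notE (X : n.-tuple R) : (forall x, 0 < x <= 1 -> Z X x <= K0 + \sum_(i < N) b i) ->
    ~ E X.
  move=> ZX; apply/negP; rewrite -leNgt; apply: abse_ereal_sup_le.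
    by exists 1; rewrite /= ltr01 lexx.
  by move=> x x01; rewrite Z0 ZX.
have n0 : 0 < n%:R :> R by rewrite ltr0n ltnW.
have l0 : 0 < ln n%:R :> R by rewrite ln_gt0// ltr1n.
have [nN|Nn] := ltnP n N.
  have -> : E = set0.
    apply/seteqP; split => X //=; apply: notE => x x01.
    have [t0 t1 _ _] := tLe x x01.
    apply: (@le_trans _ _ (b n)); last first.
      rewrite (bigD1 (Ordinal nN))//= addrCA lerDl addr_ge0// sumr_ge0// => i _.
      exact: normr_ge0.
    rewrite /b ger0_norm; last first.
      by rewrite mulr_ge0 ?divr_ge0 ?addr_ge0 ?exprn_ge0 ?(ltW l0) ?(ltW M0).
    apply: ler_pM => //; first exact: powR_ge0.
      (* The base is at least 1 and the exponent at most 1, so the normalizing power is at most n /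
         log n. *)
      have q1 : 1 <= n%:R / ln n%:R :> R by rewrite ler_pdivlMr// mul1r ln_le_id.
      rewrite -[leRHS]powRr1; last by rewrite (le_trans _ q1).
      by apply: ler_powR => //; rewrite ler_pdivrMr; lra.
    rewrite ler_norml.
    have h0 := hist_ge0 X (jhat (zeta n) (jmax n) X 0 x) x.
    have h1 := hist_le X (jhat (zeta n) (jmax n) X 0 x) x (ltnW n_gt1).
    have h2 : 2 ^+ jhat (zeta n) (jmax n) X 0 x <= 2 ^+ jmax n :> R.
      by rewrite ler_weXn2l ?ler1n// jhat_le.
    have := fM' x; have := pdf_ge0 f0 x; rewrite /fhat; lra.
  by rewrite measure0 lee_fin ltW.
move: Nn; rewrite !geq_max => /and3P[n_N1 n_N2 /lN ln_large].
have Jd : 2 ^+ jmax n * (d * ln n%:R ^+ 2) <= n%:R :> R.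
  have := jmaxP n n_gt1; rewrite ler_pdivrMr// ler_pdivlMl ?exprn_gt0//.
set l := ln n%:R in l0 ln_large Jd.
have J0 : 0 < 2 ^+ jmax n :> R by rewrite exprn_gt0.
have dl : 4 <= d * l.
  have : T1 <= l by lra.
  by rewrite ler_pdivrMr// mulrC.
have nJ : 4 * (2 ^+ jmax n * l) <= n%:R.
  apply: le_trans Jd; rewrite [leRHS](_ : _ = d * l * (2 ^+ jmax n * l)).
    by rewrite ler_pM2r// mulr_gt0.
  by ring.
have rJ : C1 * rate n (jmax n) < delta.
  have : T2 < l by lra.
  rewrite ltr_pdivrMr ?mulr_gt0 ?exprn_gt0// => C1l.
  rewrite -(@ltr_pXn2r _ 2)// ?nnegrE ?mulr_ge0 ?sqrtr_ge0 ?(ltW C10) ?(ltW delta_gt0)//.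
  rewrite exprMn sqr_rate// mulrA ltr_pdivrMr//.
  apply: lt_le_trans (ler_wpM2l (sqr_ge0 delta) Jd).
  rewrite [ltRHS](_ : _ = l * (d * delta ^+ 2) * (2 ^+ jmax n * l)).
    by rewrite ltr_pM2r// mulr_gt0.
  by ring.
have zC : `|zeta n| <= Cz * Num.sqrt l.
  by have := zN n n_N1; rewrite /= (ger0_norm (sqrtr_ge0 _)).
have l1 : 1 <= l by lra.
have [|Bad [mBad prBad goodP]] := bad_event f0 M delta alpha jmax zeta t L eta c
  Delta Cz A n (jstar n) f0_bounded delta_gt0 f0_inf alpha_gt0 UP tLe f0_holder
  cP _ n_gt1 zC l1 nJ rJ A1 cA (jN n n_N2); first by rewrite D0.
have mE : measurable E.
  apply: (measurable_saturated (jmax n)) => X Y XY; rewrite /E /=.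
  suff -> : [set (Z X x)%:E | x in [set x : R | 0 < x <= 1]] =
      [set (Z Y x)%:E | x in [set x : R | 0 < x <= 1]] by [].
  by apply: eq_imagel => x x01; rewrite /Z (fhat_quant _ _ _ X Y).
rewrite prE// lee_fin; apply: (@le_trans _ _ (pr (Pr f0 n) Bad)).
  apply: le_pr => // X EX; apply: contrapT => XBad; apply: notE EX => x x01.
  by apply: le_trans (goodP X XBad x x01) _; rewrite lerDl.
apply: le_trans prBad _; apply: expRN_le => //.
by rewrite -/Cp -/a -/T3 -/l; lra.
Qed.
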